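(* Let $\mathcal{A}$ be any category. The following are equivalent: (a) $\mathcal{A}$ is ideally regular, i.e. $\mathcal{A}$ is a regular, Bourn protomodular category with finite coproducts such that the unique morphism $0\to 1$ in $\mathcal{A}$ is effective for descent; (b) $\mathcal{A}$ is regular, has finite coproducts, and there exists a monadic functor $\mathcal{A}\to\mathcal{X}$ where $\mathcal{X}$ is homological and admits finite coproducts; (c) there exists a monadic functor $\mathcal{A}\to\mathcal{X}$ such that both $\mathcal{A}$ and $\mathcal{X}$ have finite coproducts, $\mathcal{X}$ is homological, and the underlying functor $T\colon\mathcal{X}\to\mathcal{X}$ of the corresponding monad preserves regular epimorphisms and kernel pairs.
   Context: $0$ and $1$ denote the initial and terminal objects. A category is regular if it is finitely complete, has coequalisers of kernel pairs, and regular epimorphisms are stable under pullback. For an object $X$ of a finitely complete category $\mathcal{C}$, $\mathrm{Pt}_X(\mathcal{C})$ denotes the category of points over $X$: its objects are triples $(A,\alpha\colon A\to X,\sigma\colon X\to A)$ with $\alpha\circ\sigma=1_X$, and its morphisms are the morphisms over $X$ commuting with the sections. $\mathcal{C}$ is Bourn protomodular if it is finitely complete and for every morphism $f\colon Y\to X$ the pullback functor $f^\ast\colon\mathrm{Pt}_X(\mathcal{C})\to\mathrm{Pt}_Y(\mathcal{C})$ reflects isomorphisms. A category is homological if it is pointed, regular and Bourn protomodular. In a category $\mathcal{C}$ with pullbacks, a morphism $p\colon E\to B$ is effective for descent if the pullback functor $p^\ast\colon\mathcal{C}/B\to\mathcal{C}/E$ between slice categories is monadic. A functor $U\colon\mathcal{A}\to\mathcal{X}$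 is monadic if it has a left adjoint $F$ and the comparison functor from $\mathcal{A}$ to the Eilenberg–Moore category of the monad induced by $F\dashv U$ is an equivalence; the corresponding monad is this induced monad on $\mathcal{X}$. A functor $T$ preserves kernel pairs if, whenever $(r_0,r_1)$ is the kernel pair of $f$, $(T(r_0),T(r_1))$ is the kernel pair of $T(f)$. *)

(* Defs.v *)
From Stdlib Require Import List FinFun ProofIrrelevance ClassicalEpsilon.

Set Implicit Arguments.
Unset Strict Implicit.

Declare Scope cat_scope.
Delimit Scope cat_scope with cat.
Local Open Scope cat_scope.

Record Category := MkCategory {
  Obj :> Type;
  Hom : Obj -> Obj -> Type;
  idm : forall x, Hom x x;
  comp : forall x y z, Hom y z -> Hom x y -> Hom x z;
  comp_idl : forall x y (f : Hom x y), comp (idm y) f = f;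
  comp_idr : forall x y (f : Hom x y), comp f (idm x) = f;
  comp_assoc : forall w x y z (h : Hom y z) (g : Hom x y) (f : Hom w x),
    comp h (comp g f) = comp (comp h g) f
}.
Arguments Hom {c} x y.
Arguments idm {c} x.
Arguments comp {c x y z} g f.

Notation "g \o f" := (comp g f) (at level 50, left associativity) : cat_scope.

Definition is_iso (C : Category) (x y : C) (f : Hom x y) : Prop :=
  exists g : Hom y x, g \o f = idm x /\ f \o g = idm y.

Record Functor (C D : Category) := MkFunctor {
  fobj :> Obj C -> Obj D;
  fmap : forall x y : C, Hom x y -> Hom (fobj x) (fobj y);
  fmap_id : forall x : C, fmap (idm x) = idm (fobj x);
  fmap_comp : forall (x y z : C) (g : Hom y z) (f : Hom x y),
    fmap (g \o f) = fmap g \o fmap f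
}.
Arguments fmap {C D} F {x y} f : rename.

Definition functor_id (C : Category) : Functor C C.
Proof.
  refine (@MkFunctor C C (fun x => x) (fun x y f => f) _ _); reflexivity.
Defined.

Definition functor_comp (C D E : Category) (G : Functor D E) (F : Functor C D) :
  Functor C E.
Proof.
  refine (@MkFunctor C E (fun x => G (F x)) (fun x y f => fmap G (fmap F f)) _ _).
  - intros x. now rewrite !fmap_id.
  - intros x y z g f. now rewrite !fmap_comp.
Defined.

Record NatTrans (C D : Category) (F G : Functor C D) := MkNatTrans {
  component :> forall x : C, Hom (F x) (G x);
  naturality : forall (x y : C) (f : Hom x y),
    component y \o fmap F f = fmap G f \o component x
}.

Definition naturally_isomorphic (C D : Category) (F G : Functor C D) : Prop :=
  exists t : NatTrans F G, forall x, is_iso (t x).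

Definition is_equivalence (C D : Category) (F : Functor C D) : Prop :=
  exists G : Functor D C,
    naturally_isomorphic (functor_comp G F) (functor_id C) /\
    naturally_isomorphic (functor_comp F G) (functor_id D).

Definition reflects_isos (C D : Category) (F : Functor C D) : Prop :=
  forall (x y : C) (f : Hom x y), is_iso (fmap F f) -> is_iso f.

Definition is_initial (C : Category) (i : C) : Prop :=
  forall x : C, exists! f : Hom i x, True.

Definition is_terminal (C : Category) (t : C) : Prop :=
  forall x : C, exists! f : Hom x t, True.

Definition pointed (C : Category) : Prop :=
  exists z : C, is_initial z /\ is_terminal z.

Record Cone (J C : Category) (D : Functor J C) := MkCone {
  apex : C;
  leg : forall j : J, Hom apex (D j);
  leg_nat : forall (i j : J) (u : Hom i j), fmap D u \o leg i = leg j
}.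

Definition is_limit (J C : Category) (D : Functor J C) (L : Cone D) : Prop :=
  forall K : Cone D, exists! h : Hom (apex K) (apex L),
    forall j, leg L j \o h = leg K j.

Definition finite_category (J : Category) : Prop :=
  Finite J /\ forall x y : J, Finite (Hom x y).

Definition finitely_complete (C : Category) : Prop :=
  forall J : Category, finite_category J ->
  forall D : Functor J C, exists L : Cone D, is_limit L.

Definition is_coproduct (C : Category) (I : Type) (X : I -> C)
    (s : C) (inj : forall i, Hom (X i) s) : Prop :=
  forall (y : C) (f : forall i, Hom (X i) y),
    exists! h : Hom s y, forall i, h \o inj i = f i.

Definition has_finite_coproducts (C : Category) : Prop :=
  forall I : Type, Finite I -> forall X : I -> C,
  exists (s : C) (inj : forall i, Hom (X i) s), is_coproduct inj.

Definition is_pullback (C : Category) (a b c p : C)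
    (f : Hom a c) (g : Hom b c) (p1 : Hom p a) (p2 : Hom p b) : Prop :=
  f \o p1 = g \o p2 /\
  forall (q : C) (u : Hom q a) (v : Hom q b), f \o u = g \o v ->
    exists! h : Hom q p, p1 \o h = u /\ p2 \o h = v.

Definition is_kernel_pair (C : Category) (x y r : C)
    (f : Hom x y) (r0 r1 : Hom r x) : Prop :=
  is_pullback f f r0 r1.

Definition is_coequaliser (C : Category) (r x q : C)
    (r0 r1 : Hom r x) (e : Hom x q) : Prop :=
  e \o r0 = e \o r1 /\
  forall (y : C) (f : Hom x y), f \o r0 = f \o r1 ->
    exists! h : Hom q y, h \o e = f.

Definition regular_epi (C : Category) (x q : C) (e : Hom x q) : Prop :=
  exists (r : C) (r0 r1 : Hom r x), is_coequaliser r0 r1 e.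

Definition preserves_regular_epis (C D : Category) (F : Functor C D) : Prop :=
  forall (x y : C) (e : Hom x y), regular_epi e -> regular_epi (fmap F e).

Definition preserves_kernel_pairs (C D : Category) (F : Functor C D) : Prop :=
  forall (x y r : C) (f : Hom x y) (r0 r1 : Hom r x),
    is_kernel_pair f r0 r1 -> is_kernel_pair (fmap F f) (fmap F r0) (fmap F r1).

Definition has_coequalisers_of_kernel_pairs (C : Category) : Prop :=
  forall (x y r : C) (f : Hom x y) (r0 r1 : Hom r x), is_kernel_pair f r0 r1 ->
    exists (q : C) (e : Hom x q), is_coequaliser r0 r1 e.

Definition regular_epis_pullback_stable (C : Category) : Prop :=
  forall (a b c p : C) (f : Hom a c) (g : Hom b c) (p1 : Hom p a) (p2 : Hom p b),
    is_pullback f g p1 p2 -> regular_epi f -> regular_epi p2.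

Definition regular (C : Category) : Prop :=
  finitely_complete C /\
  has_coequalisers_of_kernel_pairs C /\
  regular_epis_pullback_stable C.

Record Pullback (C : Category) (a b c : C) (f : Hom a c) (g : Hom b c) := MkPullback {
  pb_obj : C;
  pb_fst : Hom pb_obj a;
  pb_snd : Hom pb_obj b;
  pb_spec : is_pullback f g pb_fst pb_snd
}.

Definition has_pullbacks (C : Category) : Prop :=
  forall (a b c : C) (f : Hom a c) (g : Hom b c), inhabited (Pullback f g).

(* A pullback functor is only defined up to isomorphism; it is fixed by choosing
   a pullback of every cospan. *)
Definition pb (C : Category) (H : has_pullbacks C) (a b c : C)
    (f : Hom a c) (g : Hom b c) : Pullback f g :=
  epsilon (H a b c f g) (fun _ => True).

Section PullbackLift.
Variables (C : Category) (a b c : C) (f : Hom a c) (g : Hom b c) (P : Pullback f g).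

Lemma pb_comm : f \o pb_fst P = g \o pb_snd P.
Proof. exact (proj1 (pb_spec P)). Qed.

Lemma pb_hom_ext (q : C) (h k : Hom q (pb_obj P)) :
  pb_fst P \o h = pb_fst P \o k -> pb_snd P \o h = pb_snd P \o k -> h = k.
Proof.
  intros E1 E2.
  destruct (proj2 (pb_spec P) q (pb_fst P \o k) (pb_snd P \o k)) as [m [_ U]].
  - now rewrite !comp_assoc, pb_comm.
  - transitivity m; [symmetry|]; apply U; auto.
Qed.

Definition pb_lift_sig (q : C) (u : Hom q a) (v : Hom q b) (e : f \o u = g \o v) :
  { h : Hom q (pb_obj P) | pb_fst P \o h = u /\ pb_snd P \o h = v }.
Proof.
  apply constructive_indefinite_description.
  destruct (proj2 (pb_spec P) q u v e) as [h [Hh _]]. now exists h.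
Defined.

Definition pb_lift (q : C) (u : Hom q a) (v : Hom q b) (e : f \o u = g \o v) :
  Hom q (pb_obj P) := proj1_sig (pb_lift_sig e).

Lemma pb_lift_fst (q : C) (u : Hom q a) (v : Hom q b) (e : f \o u = g \o v) :
  pb_fst P \o pb_lift e = u.
Proof. exact (proj1 (proj2_sig (pb_lift_sig e))). Qed.

Lemma pb_lift_snd (q : C) (u : Hom q a) (v : Hom q b) (e : f \o u = g \o v) :
  pb_snd P \o pb_lift e = v.
Proof. exact (proj2 (proj2_sig (pb_lift_sig e))). Qed.

End PullbackLift.

Inductive cospan_obj := cs_left | cs_right | cs_base.

Definition cospan_hom (x y : cospan_obj) : Set :=
  match x, y with
  | cs_left, cs_left | cs_right, cs_right | _, cs_base => unit
  | _, _ => Empty_set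
  end.

Definition cospan : Category.
Proof.
  refine (@MkCategory cospan_obj cospan_hom
    (fun x => match x with cs_left | cs_right | cs_base => tt end)
    (fun x y z => match x, y, z with
      | cs_left, cs_left, cs_left => fun _ _ => tt
      | cs_right, cs_right, cs_right => fun _ _ => tt
      | cs_left, _, cs_base | cs_right, _, cs_base | cs_base, _, cs_base => fun _ _ => tt
      | cs_left, cs_right, _ | cs_right, cs_left, _
      | cs_base, cs_left, _ | cs_base, cs_right, _ => fun _ u => match u with end
      | _, cs_base, cs_left | _, cs_base, cs_right
      | cs_left, cs_left, cs_right | cs_right, cs_right, cs_left =>
          fun v _ => match v with end
      end) _ _ _).
  - intros [] [] []; reflexivity.
  - intros [] [] []; reflexivity.
  - intros [] [] [] [] [] [] []; reflexivity.
Defined.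

Lemma finite_cospan : finite_category cospan.
Proof.
  split.
  - exists (cs_left :: cs_right :: cs_base :: nil). intros []; simpl; auto.
  - intros [] []; first [exists (tt :: nil); intros []; simpl; auto
                        |exists nil; intros []].
Qed.

Definition cospan_functor (C : Category) (a b c : C) (f : Hom a c) (g : Hom b c) :
  Functor cospan C.
Proof.
  pose (o := fun x : cospan_obj =>
    match x with cs_left => a | cs_right => b | cs_base => c end).
  refine (@MkFunctor cospan C o
    (fun x y => match x, y return cospan_hom x y -> Hom (o x) (o y) with
      | cs_left, cs_left => fun _ => idm a
      | cs_right, cs_right => fun _ => idm b
      | cs_base, cs_base => fun _ => idm c
      | cs_left, cs_base => fun _ => f
      | cs_right, cs_base => fun _ => g
      | _, _ => fun u => match u with end
      end) _ _).
  - intros []; reflexivity.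
  - intros [] [] [] [] []; simpl; now rewrite ?comp_idl, ?comp_idr.
Defined.

Lemma finitely_complete_has_pullbacks (C : Category) :
  finitely_complete C -> has_pullbacks C.
Proof.
  intros H a b c f g.
  destruct (H _ finite_cospan (cospan_functor f g)) as [L HL].
  assert (EL := @leg_nat _ _ _ L cs_left cs_base tt).
  assert (ER := @leg_nat _ _ _ L cs_right cs_base tt).
  constructor.
  apply (@MkPullback C a b c f g (apex L) (leg L cs_left) (leg L cs_right)).
  simpl in *. split; [congruence|].
  intros q u v e.
  set (K := @MkCone _ _ (cospan_functor f g) q
    (fun j => match j return Hom q (cospan_functor f g j) with
      | cs_left => u | cs_right => v | cs_base => f \o u end)
    ltac:(intros [] [] []; simpl; rewrite ?comp_idl; auto)).
  destruct (HL K) as [h [Hh U]]. exists h. split.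
  - split; [exact (Hh cs_left)|exact (Hh cs_right)].
  - intros k [E1 E2]. apply U. intros []; simpl; auto.
    rewrite <- EL, <- E1. symmetry. apply comp_assoc.
Qed.

Section Slice.
Variables (C : Category) (X : C).

Record SliceObj := MkSliceObj {
  sl_obj : C;
  sl_map : Hom sl_obj X
}.

Record SliceHom (A B : SliceObj) := MkSliceHom {
  sl_hom : Hom (sl_obj A) (sl_obj B);
  sl_hom_map : sl_map B \o sl_hom = sl_map A
}.

Lemma slice_hom_ext (A B : SliceObj) (f g : SliceHom A B) :
  sl_hom f = sl_hom g -> f = g.
Proof.
  destruct f as [f Hf], g as [g Hg]; simpl; intros ->.
  f_equal; apply proof_irrelevance.
Qed.

Definition slice_id (A : SliceObj) : SliceHom A A.
Proof. exists (idm _). apply comp_idr. Defined.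

Definition slice_comp (A B D : SliceObj) (g : SliceHom B D) (f : SliceHom A B) :
  SliceHom A D.
Proof.
  exists (sl_hom g \o sl_hom f). abstract (now rewrite comp_assoc, !sl_hom_map).
Defined.

Definition Slice : Category.
Proof.
  refine (@MkCategory SliceObj SliceHom slice_id slice_comp _ _ _);
    intros; apply slice_hom_ext; simpl.
  - apply comp_idl.
  - apply comp_idr.
  - apply comp_assoc.
Defined.

End Slice.

Section SlicePullback.
Variables (C : Category) (H : has_pullbacks C) (Y X : C) (f : Hom Y X).

Definition slice_pb_obj (A : Slice X) : Slice Y :=
  @MkSliceObj C Y _ (pb_snd (pb H (sl_map A) f)).

Definition slice_pb_hom (A B : Slice X) (h : Hom A B) :
  Hom (slice_pb_obj A) (slice_pb_obj B).
Proof.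
  unshelve refine (@MkSliceHom C Y (slice_pb_obj A) (slice_pb_obj B)
    (pb_lift (pb H (sl_map B) f) (u := sl_hom h \o pb_fst (pb H (sl_map A) f))
       (v := pb_snd (pb H (sl_map A) f)) _) _).
  - abstract (rewrite comp_assoc, sl_hom_map; apply pb_comm).
  - abstract (apply pb_lift_snd).
Defined.

Definition slice_pullback : Functor (Slice X) (Slice Y).
Proof.
  refine (@MkFunctor (Slice X) (Slice Y) slice_pb_obj slice_pb_hom _ _).
  - intros A. apply slice_hom_ext, pb_hom_ext; simpl.
    + now rewrite pb_lift_fst, comp_idl, comp_idr.
    + now rewrite pb_lift_snd, comp_idr.
  - intros A B D g h. apply slice_hom_ext, pb_hom_ext; simpl.
    + now rewrite comp_assoc, !pb_lift_fst, <- !comp_assoc, pb_lift_fst.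
    + now rewrite comp_assoc, !pb_lift_snd.
Defined.

End SlicePullback.

Section Points.
Variables (C : Category) (X : C).

Record PtObj := MkPtObj {
  pt_obj : C;
  pt_map : Hom pt_obj X;
  pt_sec : Hom X pt_obj;
  pt_split : pt_map \o pt_sec = idm X
}.

Record PtHom (A B : PtObj) := MkPtHom {
  pt_hom : Hom (pt_obj A) (pt_obj B);
  pt_hom_map : pt_map B \o pt_hom = pt_map A;
  pt_hom_sec : pt_hom \o pt_sec A = pt_sec B
}.

Lemma pt_hom_ext (A B : PtObj) (f g : PtHom A B) : pt_hom f = pt_hom g -> f = g.
Proof.
  destruct f as [f Hf Kf], g as [g Hg Kg]; simpl; intros ->.
  f_equal; apply proof_irrelevance.
Qed.

Definition pt_id (A : PtObj) : PtHom A A.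
Proof. exists (idm _). apply comp_idr. apply comp_idl. Defined.

Definition pt_comp (A B D : PtObj) (g : PtHom B D) (f : PtHom A B) : PtHom A D.
Proof.
  exists (pt_hom g \o pt_hom f).
  - abstract (now rewrite comp_assoc, !pt_hom_map).
  - abstract (now rewrite <- comp_assoc, !pt_hom_sec).
Defined.

Definition Pt : Category.
Proof.
  refine (@MkCategory PtObj PtHom pt_id pt_comp _ _ _);
    intros; apply pt_hom_ext; simpl.
  - apply comp_idl.
  - apply comp_idr.
  - apply comp_assoc.
Defined.

End Points.

Section PointsPullback.
Variables (C : Category) (H : has_pullbacks C) (Y X : C) (f : Hom Y X).

Definition pt_pb_obj (A : Pt X) : Pt Y.
Proof.
  unshelve refine (@MkPtObj C Y (pb_obj (pb H (pt_map A) f)) (pb_snd (pb H (pt_map A) f))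
    (pb_lift (pb H (pt_map A) f) (u := pt_sec A \o f) (v := idm Y) _) _).
  - abstract (now rewrite comp_assoc, pt_split, comp_idl, comp_idr).
  - abstract (apply pb_lift_snd).
Defined.

Definition pt_pb_hom (A B : Pt X) (h : Hom A B) : Hom (pt_pb_obj A) (pt_pb_obj B).
Proof.
  unshelve refine (@MkPtHom C Y (pt_pb_obj A) (pt_pb_obj B)
    (pb_lift (pb H (pt_map B) f) (u := pt_hom h \o pb_fst (pb H (pt_map A) f))
       (v := pb_snd (pb H (pt_map A) f)) _) _ _).
  - abstract (rewrite comp_assoc, pt_hom_map; apply pb_comm).
  - abstract (apply pb_lift_snd).
  - abstract (apply pb_hom_ext; simpl;
      [now rewrite comp_assoc, !pb_lift_fst, <- comp_assoc, pb_lift_fst,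
         comp_assoc, pt_hom_sec
      |now rewrite comp_assoc, !pb_lift_snd]).
Defined.

Definition pt_pullback : Functor (Pt X) (Pt Y).
Proof.
  refine (@MkFunctor (Pt X) (Pt Y) pt_pb_obj pt_pb_hom _ _).
  - intros A. apply pt_hom_ext, pb_hom_ext; simpl.
    + now rewrite pb_lift_fst, comp_idl, comp_idr.
    + now rewrite pb_lift_snd, comp_idr.
  - intros A B D g h. apply pt_hom_ext, pb_hom_ext; simpl.
    + now rewrite comp_assoc, !pb_lift_fst, <- !comp_assoc, pb_lift_fst.
    + now rewrite comp_assoc, !pb_lift_snd.
Defined.

End PointsPullback.

Definition protomodular (C : Category) : Prop :=
  exists H : finitely_complete C, forall (Y X : C) (f : Hom Y X),
    reflects_isos (pt_pullback (finitely_complete_has_pullbacks H) f).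

Definition homological (C : Category) : Prop :=
  pointed C /\ regular C /\ protomodular C.

Record Adjunction (X A : Category) (F : Functor X A) (U : Functor A X) := MkAdjunction {
  unit_ : NatTrans (functor_id X) (functor_comp U F);
  counit : NatTrans (functor_comp F U) (functor_id A);
  triangle_left : forall x : X, counit (F x) \o fmap F (unit_ x) = idm (F x);
  triangle_right : forall a : A, fmap U (counit a) \o unit_ (U a) = idm (U a)
}.

Record Monad (X : Category) := MkMonad {
  monad_functor :> Functor X X;
  monad_unit : NatTrans (functor_id X) monad_functor;
  monad_mult : NatTrans (functor_comp monad_functor monad_functor) monad_functor;
  monad_unit_l : forall x : X, monad_mult x \o monad_unit (monad_functor x) = idm _;
  monad_unit_r : forall x : X, monad_mult x \o fmap monad_functor (monad_unit x) = idm _;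
  monad_mult_assoc : forall x : X,
    monad_mult x \o fmap monad_functor (monad_mult x) =
    monad_mult x \o monad_mult (monad_functor x)
}.

Section InducedMonad.
Variables (X A : Category) (F : Functor X A) (U : Functor A X) (adj : Adjunction F U).

Definition induced_mult :
  NatTrans (functor_comp (functor_comp U F) (functor_comp U F)) (functor_comp U F).
Proof.
  refine (@MkNatTrans _ _ (functor_comp (functor_comp U F) (functor_comp U F))
    (functor_comp U F) (fun x => fmap U (counit adj (F x))) _).
  abstract (intros x y f; simpl; rewrite <- !fmap_comp; f_equal;
    exact (naturality (counit adj) (fmap F f))).
Defined.

Definition induced_monad : Monad X.
Proof.
  refine (@MkMonad X (functor_comp U F) (unit_ adj) induced_mult _ _ _);
    intros x; simpl.
  - apply triangle_right.
  - abstract (rewrite <- fmap_comp; etransitivity;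
      [exact (f_equal _ (triangle_left adj x))|apply fmap_id]).
  - abstract (rewrite <- !fmap_comp; f_equal;
      exact (naturality (counit adj) (counit adj (F x)))).
Defined.

End InducedMonad.

Section EilenbergMoore.
Variables (X : Category) (T : Monad X).

Record Algebra := MkAlgebra {
  alg_obj : X;
  alg_act : Hom (T alg_obj) alg_obj;
  alg_unit : alg_act \o monad_unit T alg_obj = idm alg_obj;
  alg_assoc : alg_act \o fmap T alg_act = alg_act \o monad_mult T alg_obj
}.

Record AlgebraHom (P Q : Algebra) := MkAlgebraHom {
  alg_hom : Hom (alg_obj P) (alg_obj Q);
  alg_hom_act : alg_hom \o alg_act P = alg_act Q \o fmap T alg_hom
}.

Lemma alg_hom_ext (P Q : Algebra) (f g : AlgebraHom P Q) :
  alg_hom f = alg_hom g -> f = g.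
Proof.
  destruct f as [f Hf], g as [g Hg]; simpl; intros ->.
  f_equal; apply proof_irrelevance.
Qed.

Definition alg_id (P : Algebra) : AlgebraHom P P.
Proof. exists (idm _). abstract (now rewrite fmap_id, comp_idl, comp_idr). Defined.

Definition alg_comp (P Q R : Algebra) (g : AlgebraHom Q R) (f : AlgebraHom P Q) :
  AlgebraHom P R.
Proof.
  exists (alg_hom g \o alg_hom f).
  abstract (now rewrite fmap_comp, <- comp_assoc, alg_hom_act, !comp_assoc, alg_hom_act).
Defined.

Definition EilenbergMoore : Category.
Proof.
  refine (@MkCategory Algebra AlgebraHom alg_id alg_comp _ _ _);
    intros; apply alg_hom_ext; simpl.
  - apply comp_idl.
  - apply comp_idr.
  - apply comp_assoc.
Defined.

End EilenbergMoore.

Section Comparison.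
Variables (X A : Category) (F : Functor X A) (U : Functor A X) (adj : Adjunction F U).

Definition comparison_obj (a : A) : EilenbergMoore (induced_monad adj).
Proof.
  refine (@MkAlgebra X (induced_monad adj) (U a) (fmap U (counit adj a)) _ _).
  - apply triangle_right.
  - abstract (simpl; rewrite <- !fmap_comp; f_equal;
      exact (naturality (counit adj) (counit adj a))).
Defined.

Definition comparison_hom (a b : A) (f : Hom a b) :
  Hom (comparison_obj a) (comparison_obj b).
Proof.
  refine (@MkAlgebraHom X (induced_monad adj) (comparison_obj a) (comparison_obj b)
    (fmap U f) _).
  abstract (simpl; rewrite <- !fmap_comp; f_equal;
    symmetry; exact (naturality (counit adj) f)).
Defined.

Definition comparison : Functor A (EilenbergMoore (induced_monad adj)).
Proof.
  refine (@MkFunctor A (EilenbergMoore (induced_monad adj))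
    comparison_obj comparison_hom _ _);
    intros; apply alg_hom_ext; simpl.
  - apply fmap_id.
  - apply fmap_comp.
Defined.

End Comparison.

Definition monadic (A X : Category) (U : Functor A X) : Prop :=
  exists (F : Functor X A) (adj : Adjunction F U), is_equivalence (comparison adj).

Definition effective_descent (C : Category) (H : has_pullbacks C) (E B : C)
    (p : Hom E B) : Prop :=
  monadic (slice_pullback H p).

(* [z] and [t] below exist by the other conjuncts. *)
Definition ideally_regular (A : Category) : Prop :=
  regular A /\
  protomodular A /\
  has_finite_coproducts A /\
  exists H : has_pullbacks A,
    forall (z t : A) (m : Hom z t), is_initial z -> is_terminal t ->
      effective_descent H m.

(* Main.v *)
Require Import Defs.
From Stdlib Require Import List FinFun ClassicalEpsilon.

Set Implicit Arguments.
Unset Strict Implicit.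
Local Open Scope cat_scope.

(* If [A] is ideally regular, the homological category is the slice [A/0], and the
   monadic functor is [a |-> a x 0], i.e. base change along [0 -> 1]; its monad is a left
   adjoint [A/0 -> A] followed by a pullback functor, hence preserves regular epimorphisms
   and kernel pairs.

   Conversely let [U : A -> X] be monadic with [X] homological. Protomodularity lifts along
   [U], which preserves pullbacks and reflects isomorphisms. For descent along [0 -> 1],
   consider [V : A/0 -> X] sending [x : a -> 0] to the kernel of [U x]. Every object of
   [A/0] is split by the map out of [0], so [V] is conservative by protomodularity of [X];
   and [V (a x 0)] is [U a], because [U 1] is a zero object. Hence Beck's condition passes
   from [U] to base change along [0 -> 1].

   If the monad [T] preserves regular epimorphisms and kernel pairs, the coequaliser [q] in
   [X] of a kernel pair of algebras is such that [T q] and [T (T q)] are again coequalisers,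
   so it lifts to algebras; this makes [A] regular. *)

(** * Isomorphisms, and maps into terminal and out of initial objects *)

Lemma comp_cong_l (C : Category) (a b c d : C) (f : Hom a b) (g : Hom b c)
    (k : Hom a c) (E : g \o f = k) (h : Hom c d) : h \o g \o f = h \o k.
Proof. now rewrite <- comp_assoc, E. Qed.

Lemma is_iso_comp (C : Category) (a b c : C) (f : Hom a b) (g : Hom b c) :
  is_iso f -> is_iso g -> is_iso (g \o f).
Proof.
  intros [f' [E1 E2]] [g' [E3 E4]]. exists (f' \o g'). split; rewrite !comp_assoc.
  - now rewrite (comp_cong_l E3), comp_idr.
  - now rewrite (comp_cong_l E2), comp_idr.
Qed.

Lemma is_iso_fmap (C D : Category) (F : Functor C D) (a b : C) (f : Hom a b) :
  is_iso f -> is_iso (fmap F f).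
Proof.
  intros [g [E1 E2]]. exists (fmap F g). now rewrite <- !fmap_comp, E1, E2, !fmap_id.
Qed.

Lemma is_iso_of_comp_l (C : Category) (a b c : C) (f : Hom a b) (g : Hom b c) :
  is_iso g -> is_iso (g \o f) -> is_iso f.
Proof.
  intros [g' [E1 E2]] [k [E3 E4]]. exists (k \o g). split.
  - now rewrite <- comp_assoc.
  - assert (E : f \o k = g').
    { rewrite <- (comp_idl (f \o k)), <- E1, <- comp_assoc, (comp_assoc g f k), E4.
      apply comp_idr. }
    now rewrite comp_assoc, E.
Qed.

Lemma is_iso_of_comp_r (C : Category) (a b c : C) (f : Hom a b) (g : Hom b c) :
  is_iso f -> is_iso (g \o f) -> is_iso g.
Proof.
  intros [f' [E1 E2]] [k [E3 E4]]. exists (f \o k). split.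
  - assert (E : k \o g = f').
    { rewrite <- (comp_idr (k \o g)), <- E2, comp_assoc, <- (comp_assoc k g f), E3.
      apply comp_idl. }
    now rewrite <- comp_assoc, E.
  - now rewrite comp_assoc.
Qed.

Lemma is_iso_cancel_l (C : Category) (a b c : C) (m : Hom b c) (f g : Hom a b) :
  is_iso m -> m \o f = m \o g -> f = g.
Proof.
  intros [n [E _]] H. rewrite <- (comp_idl f), <- (comp_idl g), <- E, <- !comp_assoc.
  now rewrite H.
Qed.

Lemma is_iso_cancel_r (C : Category) (a b c : C) (e : Hom a b) (f g : Hom b c) :
  is_iso e -> f \o e = g \o e -> f = g.
Proof.
  intros [n [_ E]] H. rewrite <- (comp_idr f), <- (comp_idr g), <- E, !comp_assoc.
  now rewrite H.
Qed.

Lemma terminal_hom_eq (C : Category) (t x : C) (f g : Hom x t) :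
  is_terminal t -> f = g.
Proof. intros H. destruct (H x) as [h [_ U]]. now rewrite <- (U f I), <- (U g I). Qed.

Lemma initial_hom_eq (C : Category) (i x : C) (f g : Hom i x) :
  is_initial i -> f = g.
Proof. intros H. destruct (H x) as [h [_ U]]. now rewrite <- (U f I), <- (U g I). Qed.

(** * Pullbacks *)

Lemma pullback_ext (C : Category) (a b c p : C) (f : Hom a c) (g : Hom b c)
    (p1 : Hom p a) (p2 : Hom p b) : is_pullback f g p1 p2 ->
  forall q (h k : Hom q p), p1 \o h = p1 \o k -> p2 \o h = p2 \o k -> h = k.
Proof. intros P q h k. exact (@pb_hom_ext C a b c f g (MkPullback P) q h k). Qed.

Lemma pullback_lift (C : Category) (a b c p : C) (f : Hom a c) (g : Hom b c)
    (p1 : Hom p a) (p2 : Hom p b) : is_pullback f g p1 p2 ->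
  forall q (u : Hom q a) (v : Hom q b), f \o u = g \o v ->
  exists h : Hom q p, p1 \o h = u /\ p2 \o h = v.
Proof. intros [_ P] q u v e. destruct (P q u v e) as [h [Hh _]]. now exists h. Qed.

Lemma pullback_intro (C : Category) (a b c p : C) (f : Hom a c) (g : Hom b c)
    (p1 : Hom p a) (p2 : Hom p b) :
  f \o p1 = g \o p2 ->
  (forall q (u : Hom q a) (v : Hom q b), f \o u = g \o v ->
    exists h : Hom q p, p1 \o h = u /\ p2 \o h = v) ->
  (forall q (h k : Hom q p), p1 \o h = p1 \o k -> p2 \o h = p2 \o k -> h = k) ->
  is_pullback f g p1 p2.
Proof.
  intros E L U. split; [exact E|]. intros q u v e.
  destruct (L q u v e) as [h [E1 E2]]. exists h. split; [auto|].
  intros k [K1 K2]. apply U; congruence.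
Qed.

Lemma pullback_along_iso (C : Category) (a b c p : C) (f : Hom a c) (g : Hom b c)
    (p1 : Hom p a) (p2 : Hom p b) :
  is_pullback f g p1 p2 -> is_iso g -> is_iso p1.
Proof.
  intros P [g' [E1 E2]].
  destruct (pullback_lift P (u := idm a) (v := g' \o f)) as [h [H1 H2]].
  { now rewrite comp_assoc, E2, comp_idl, comp_idr. }
  exists h. split; [|exact H1].
  apply (pullback_ext P); rewrite comp_assoc, comp_idr.
  - now rewrite H1, comp_idl.
  - now rewrite H2, <- comp_assoc, (proj1 P), comp_assoc, E1, comp_idl.
Qed.

Lemma pullback_paste (C : Category) (a b c p x y : C) (f : Hom a c) (g : Hom b c)
    (p1 : Hom p a) (p2 : Hom p b) (k : Hom x b) (q1 : Hom y p) (q2 : Hom y x) :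
  is_pullback f g p1 p2 -> is_pullback p2 k q1 q2 ->
  is_pullback f (g \o k) (p1 \o q1) q2.
Proof.
  intros P Q. apply pullback_intro.
  - now rewrite comp_assoc, (proj1 P), <- !comp_assoc, (proj1 Q).
  - intros q u v e. rewrite <- comp_assoc in e.
    destruct (pullback_lift P e) as [h [E1 E2]].
    destruct (pullback_lift Q E2) as [h' [E3 E4]].
    exists h'. now rewrite <- comp_assoc, E3.
  - intros q h h' E1 E2. rewrite <- !comp_assoc in E1. apply (pullback_ext Q); auto.
    apply (pullback_ext P); auto.
    now rewrite !comp_assoc, (proj1 Q), <- !comp_assoc, E2.
Qed.

(** Since [f] factors through [e], two maps identified by [e] are identified by [f] and hence lift
    to [r]. *)
Lemma kernel_pair_of_coequaliser (C : Category) (x y r q : C) (f : Hom x y)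
    (r0 r1 : Hom r x) (e : Hom x q) :
  is_kernel_pair f r0 r1 -> is_coequaliser r0 r1 e -> is_kernel_pair e r0 r1.
Proof.
  intros P [E Q]. destruct (Q y f (proj1 P)) as [m [Em _]]. apply pullback_intro.
  - exact E.
  - intros w u v H. apply (pullback_lift P). now rewrite <- Em, <- !comp_assoc, H.
  - apply (pullback_ext P).
Qed.

(** * Coequalisers *)

Lemma coequaliser_epi (C : Category) (r x q : C) (r0 r1 : Hom r x) (e : Hom x q) :
  is_coequaliser r0 r1 e -> forall y (h k : Hom q y), h \o e = k \o e -> h = k.
Proof.
  intros [E Q] y h k H. destruct (Q y (h \o e)) as [m [_ U]].
  - now rewrite <- !comp_assoc, E.
  - transitivity m; [symmetry|]; apply U; auto.
Qed.

Lemma coequaliser_desc (C : Category) (r x q : C) (r0 r1 : Hom r x) (e : Hom x q) :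
  is_coequaliser r0 r1 e -> forall y (f : Hom x y), f \o r0 = f \o r1 ->
  exists h : Hom q y, h \o e = f.
Proof. intros [_ Q] y f H. destruct (Q y f H) as [h [Hh _]]. now exists h. Qed.

Lemma coequaliser_intro (C : Category) (r x q : C) (r0 r1 : Hom r x) (e : Hom x q) :
  e \o r0 = e \o r1 ->
  (forall y (f : Hom x y), f \o r0 = f \o r1 -> exists h : Hom q y, h \o e = f) ->
  (forall y (h k : Hom q y), h \o e = k \o e -> h = k) ->
  is_coequaliser r0 r1 e.
Proof.
  intros E D U. split; [exact E|]. intros y f H. destruct (D y f H) as [h Hh].
  exists h. split; [exact Hh|]. intros k Hk. apply U. congruence.
Qed.

Lemma coequaliser_unique (C : Category) (r x q q' : C) (r0 r1 : Hom r x)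
    (e : Hom x q) (e' : Hom x q') (k : Hom q q') :
  is_coequaliser r0 r1 e -> is_coequaliser r0 r1 e' -> k \o e = e' -> is_iso k.
Proof.
  intros Q Q' E. destruct (coequaliser_desc Q' (proj1 Q)) as [l El].
  exists l. split.
  - apply (coequaliser_epi Q). now rewrite <- comp_assoc, E, El, comp_idl.
  - apply (coequaliser_epi Q'). now rewrite <- comp_assoc, El, E, comp_idl.
Qed.

Lemma coequaliser_iso (C : Category) (r x q q' : C) (r0 r1 : Hom r x)
    (e : Hom x q) (k : Hom q q') :
  is_coequaliser r0 r1 e -> is_iso k -> is_coequaliser r0 r1 (k \o e).
Proof.
  intros Q K. apply coequaliser_intro.
  - now rewrite <- !comp_assoc, (proj1 Q).
  - intros y f H. destruct (coequaliser_desc Q H) as [h Hh].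
    destruct K as [l [E _]]. exists (h \o l).
    now rewrite comp_assoc, (comp_cong_l E), comp_idr.
  - intros y h h' H. apply (is_iso_cancel_r K), (coequaliser_epi Q).
    now rewrite <- !comp_assoc.
Qed.

(** Any pair of which [e] is the coequaliser factors through the kernel pair of [e], so a map
    equalising the kernel pair equalises that pair too. *)
Lemma regular_epi_coequaliser_of_kernel_pair (C : Category) (x y r : C) (e : Hom x y)
    (r0 r1 : Hom r x) :
  regular_epi e -> is_kernel_pair e r0 r1 -> is_coequaliser r0 r1 e.
Proof.
  intros [s [s0 [s1 Q]]] P. apply coequaliser_intro.
  - apply P.
  - intros z f H. apply (coequaliser_desc Q).
    destruct (pullback_lift P (proj1 Q)) as [h [<- <-]]. now rewrite !comp_assoc, H.
  - apply (coequaliser_epi Q).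
Qed.

(** Beck's split fork: [s] splits [e] and [t] splits [r0]. The conditions are equations between
    composites, so every functor preserves them. *)
Definition split_coequaliser (C : Category) (r x q : C) (r0 r1 : Hom r x)
    (e : Hom x q) : Prop :=
  e \o r0 = e \o r1 /\ exists (s : Hom q x) (t : Hom x r),
    e \o s = idm q /\ r0 \o t = idm x /\ r1 \o t = s \o e.

Lemma split_coequaliser_is_coequaliser (C : Category) (r x q : C) (r0 r1 : Hom r x)
    (e : Hom x q) : split_coequaliser r0 r1 e -> is_coequaliser r0 r1 e.
Proof.
  intros [E [s [t [E1 [E2 E3]]]]]. apply coequaliser_intro; [exact E| |].
  - intros y f H. exists (f \o s).
    now rewrite <- comp_assoc, <- E3, comp_assoc, <- H, <- comp_assoc, E2, comp_idr.
  - intros y h k H. now rewrite <- (comp_idr h), <- (comp_idr k), <- E1, !comp_assoc, H.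
Qed.

Lemma split_coequaliser_fmap (C D : Category) (F : Functor C D) (r x q : C)
    (r0 r1 : Hom r x) (e : Hom x q) :
  split_coequaliser r0 r1 e -> split_coequaliser (fmap F r0) (fmap F r1) (fmap F e).
Proof.
  intros [E [s [t [E1 [E2 E3]]]]]. split; [now rewrite <- !fmap_comp, E|].
  exists (fmap F s), (fmap F t). rewrite <- !fmap_comp, E1, E2, E3, !fmap_id. auto.
Qed.

(** The maps [G r0] and [G r1] are conjugates of [F r0] and [F r1] by the components of [t];
    conjugating the splitting as well gives a split fork with the same quotient [q]. *)
Lemma split_coequaliser_transport (C D : Category) (F G : Functor C D) (t : NatTrans F G)
    (r x : C) (r0 r1 : Hom r x) (q : D) (e : Hom (F x) q) :
  (forall c, is_iso (t c)) -> split_coequaliser (fmap F r0) (fmap F r1) e ->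
  exists e' : Hom (G x) q, split_coequaliser (fmap G r0) (fmap G r1) e' /\ e' \o t x = e.
Proof.
  intros It [E [s [p [E1 [E2 E3]]]]].
  destruct (It x) as [n [N1 N2]], (It r) as [m [M1 M2]].
  assert (K : forall k : Hom r x, fmap G k = t x \o fmap F k \o m).
  { intros k. now rewrite (naturality t), <- comp_assoc, M2, comp_idr. }
  exists (e \o n). split; [|now rewrite <- comp_assoc, N1, comp_idr].
  rewrite !K. split.
  - now rewrite !comp_assoc, !(comp_cong_l N1), !comp_idr, E.
  - exists (t x \o s), (t r \o p \o n). rewrite !comp_assoc.
    rewrite !(comp_cong_l N1), !(comp_cong_l M1), !comp_idr, E1.
    now rewrite !(comp_cong_l E2), !(comp_cong_l E3), comp_idr, comp_assoc.
Qed.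

(** * Existence and uniqueness for maps into a limit *)

Lemma limit_lift (J C : Category) (D : Functor J C) (L : Cone D) (HL : is_limit L)
    (q : C) (f : forall j, Hom q (D j)) :
  (forall i j (u : Hom i j), fmap D u \o f i = f j) ->
  exists h : Hom q (apex L), forall j, leg L j \o h = f j.
Proof.
  intros Hf. destruct (HL (MkCone Hf)) as [h [Hh _]]. now exists h.
Qed.

Lemma limit_ext (J C : Category) (D : Functor J C) (L : Cone D) (HL : is_limit L)
    (q : C) (h k : Hom q (apex L)) :
  (forall j, leg L j \o h = leg L j \o k) -> h = k.
Proof.
  intros H.
  assert (Hk : forall i j (u : Hom i j), fmap D u \o (leg L i \o k) = leg L j \o k).
  { intros i j u. now rewrite comp_assoc, leg_nat. }
  destruct (HL (MkCone Hk)) as [m [_ U]].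
  transitivity m; [symmetry|]; apply U; auto.
Qed.

(** * Equivalences *)

Lemma equivalence_faithful (C D : Category) (K : Functor C D) : is_equivalence K ->
  forall a b (f g : Hom a b), fmap K f = fmap K g -> f = g.
Proof.
  intros [G [[t It] _]] a b f g E.
  apply (is_iso_cancel_r (It a)).
  transitivity (t b \o fmap (functor_comp G K) f); [symmetry; exact (naturality t f)|].
  transitivity (t b \o fmap (functor_comp G K) g); [|exact (naturality t g)].
  simpl. now rewrite E.
Qed.

Lemma equivalence_inverse (C D : Category) (K : Functor C D) : is_equivalence K ->
  exists G : Functor D C, is_equivalence G /\
    naturally_isomorphic (functor_comp G K) (functor_id C) /\
    naturally_isomorphic (functor_comp K G) (functor_id D).
Proof. intros [G [H1 H2]]. exists G. split; [now exists K|auto]. Qed.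

(** The preimage of [h] is the conjugate of [G h] by the isomorphism from [G K] to the identity. The
    inverse [G] is itself an equivalence, hence faithful, so it suffices to compare images under
    [G]. *)
Lemma equivalence_full (C D : Category) (K : Functor C D) : is_equivalence K ->
  forall a b (h : Hom (K a) (K b)), exists f, fmap K f = h.
Proof.
  intros HK a b h. destruct (equivalence_inverse HK) as [G [HG [[t It] _]]].
  destruct (It a) as [t' [E1 E2]]. exists (t b \o fmap G h \o t').
  apply (equivalence_faithful HG), (is_iso_cancel_l (It b)).
  etransitivity; [exact (naturality t (t b \o fmap G h \o t'))|]. cbn in *.
  now rewrite <- comp_assoc, E1, comp_idr.
Qed.

Lemma equivalence_surj (C D : Category) (K : Functor C D) : is_equivalence K ->
  forall y, exists a (i : Hom (K a) y), is_iso i.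
Proof. intros [G [_ [s Is]]] y. exists (G y), (s y). apply Is. Qed.

(** An inverse functor is obtained by choosing for each [y] a preimage [o y] with an isomorphism
    [i y] onto [y]. Full faithfulness then determines its action on morphisms, and functoriality
    follows from uniqueness. *)
Lemma is_equivalence_intro (C D : Category) (K : Functor C D) :
  (forall a b (f g : Hom a b), fmap K f = fmap K g -> f = g) ->
  (forall a b (h : Hom (K a) (K b)), exists f, fmap K f = h) ->
  (forall y, exists a (i : Hom (K a) y), is_iso i) ->
  is_equivalence K.
Proof.
  intros Faith Full Surj.
  assert (S : forall y, { p : { a & Hom (K a) y } | is_iso (projT2 p) }).
  { intros y. apply constructive_indefinite_description.
    destruct (Surj y) as [a [i Hi]]. now exists (existT _ a i). }
  pose (o := fun y => projT1 (proj1_sig (S y))).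
  pose (i := fun y => projT2 (proj1_sig (S y)) : Hom (K (o y)) y).
  assert (Hi : forall y, is_iso (i y)) by (intros y; exact (proj2_sig (S y))).
  clearbody i. clearbody o. clear S Surj.
  assert (M : forall y z (f : Hom y z),
    { h : Hom (o y) (o z) | i z \o fmap K h = f \o i y }).
  { intros y z f. apply constructive_indefinite_description.
    destruct (Hi z) as [j [_ E]]. destruct (Full _ _ (j \o (f \o i y))) as [h Hh].
    exists h. now rewrite Hh, comp_assoc, E, comp_idl. }
  assert (Ext : forall a z (h k : Hom a (o z)),
    i z \o fmap K h = i z \o fmap K k -> h = k).
  { intros a z h k E. apply Faith, (is_iso_cancel_l (Hi z)), E. }
  unshelve epose (G := @MkFunctor D C o (fun y z f => proj1_sig (M y z f)) _ _).
  - intros y. apply Ext. destruct (M y y (idm y)) as [h Hh]; simpl.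
    now rewrite Hh, fmap_id, comp_idl, comp_idr.
  - intros x y z g f. apply Ext.
    destruct (M _ _ (g \o f)) as [h1 H1], (M _ _ g) as [h2 H2], (M _ _ f) as [h3 H3].
    simpl. now rewrite fmap_comp, comp_assoc, H2, <- comp_assoc, H3, H1, comp_assoc.
  - assert (HG : forall y z (f : Hom y z), i z \o fmap K (fmap G f) = f \o i y)
      by (intros y z f; exact (proj2_sig (M y z f))).
    exists G. split.
    (* The component at [a] is the preimage under [K] of the chosen isomorphism at [K a]; naturality
       is checked after applying [K]. *)
    + assert (N : forall a, { t : Hom (G (K a)) a | fmap K t = i (K a) }).
      { intros a. apply constructive_indefinite_description, Full. }
      unshelve eexists (@MkNatTrans _ _ (functor_comp G K) (functor_id C)
        (fun a => proj1_sig (N a)) _).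
      * intros a b f. apply Faith. cbn [functor_comp functor_id fmap fobj].
        rewrite !fmap_comp, (proj2_sig (N a)), (proj2_sig (N b)). apply HG.
      * intros a. cbn. destruct (N a) as [n Hn]; cbn.
        destruct (Hi (K a)) as [j [E1 E2]]. destruct (Full _ _ j) as [m Hm].
        exists m. split; apply Faith; rewrite fmap_comp, fmap_id.
        { etransitivity; [exact (f_equal2 comp Hm Hn)|exact E1]. }
        { etransitivity; [exact (f_equal2 comp Hn Hm)|exact E2]. }
    + unshelve eexists (@MkNatTrans _ _ (functor_comp K G) (functor_id D) i _).
      * exact HG.
      * exact Hi.
Qed.

(** * Adjunctions *)

Section Adjunctions.
Variables (X A : Category) (F : Functor X A) (U : Functor A X) (adj : Adjunction F U).

(** The codomain is written [U (F x)] instead of through the composite functor, so that rewriting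
    can match it syntactically. *)
Definition adj_unit (x : X) : Hom x (U (F x)) := unit_ adj x.
Definition adj_counit (a : A) : Hom (F (U a)) a := counit adj a.

Lemma adj_triangle_l (x : X) : adj_counit (F x) \o fmap F (adj_unit x) = idm (F x).
Proof. exact (triangle_left adj x). Qed.

Lemma adj_triangle_r (a : A) : fmap U (adj_counit a) \o adj_unit (U a) = idm (U a).
Proof. exact (triangle_right adj a). Qed.

Lemma counit_nat (a b : A) (f : Hom a b) :
  adj_counit b \o fmap F (fmap U f) = f \o adj_counit a.
Proof. exact (naturality (counit adj) f). Qed.

Lemma unit_nat (x y : X) (f : Hom x y) :
  fmap U (fmap F f) \o adj_unit x = adj_unit y \o f.
Proof. symmetry. exact (naturality (unit_ adj) f). Qed.

(** A map out of [F x] is recovered from its transpose by applying [F] and composing with the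
    counit. *)
Lemma transpose_inj (x : X) (a : A) (f g : Hom (F x) a) :
  fmap U f \o adj_unit x = fmap U g \o adj_unit x -> f = g.
Proof.
  assert (K : forall h : Hom (F x) a,
    h = adj_counit a \o fmap F (fmap U h \o adj_unit x)).
  { intros h. rewrite fmap_comp, comp_assoc, counit_nat, <- comp_assoc.
    now rewrite adj_triangle_l, comp_idr. }
  intros E. now rewrite (K f), (K g), E.
Qed.

Lemma transpose_ex (x : X) (a : A) (k : Hom x (U a)) :
  exists f : Hom (F x) a, fmap U f \o adj_unit x = k.
Proof.
  exists (adj_counit a \o fmap F k).
  now rewrite fmap_comp, <- comp_assoc, unit_nat, comp_assoc, adj_triangle_r, comp_idl.
Qed.

(** Cones with vertex [q] over the image cospan are the transposes of cones with vertex [F q] over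
    the original one. *)
Lemma right_adjoint_pullback (a b c p : A) (f : Hom a c) (g : Hom b c)
    (p1 : Hom p a) (p2 : Hom p b) :
  is_pullback f g p1 p2 -> is_pullback (fmap U f) (fmap U g) (fmap U p1) (fmap U p2).
Proof.
  intros P. apply pullback_intro.
  - now rewrite <- !fmap_comp, (proj1 P).
  - intros q u v E.
    destruct (transpose_ex u) as [u' <-], (transpose_ex v) as [v' <-].
    destruct (pullback_lift P (u := u') (v := v')) as [h [E1 E2]].
    { apply transpose_inj. now rewrite !fmap_comp, <- !comp_assoc. }
    exists (fmap U h \o adj_unit q). now rewrite !comp_assoc, <- !fmap_comp, E1, E2.
  - intros q h k.
    destruct (transpose_ex h) as [h' <-], (transpose_ex k) as [k' <-].
    rewrite !comp_assoc, <- !fmap_comp. intros E1 E2.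
    apply transpose_inj in E1. apply transpose_inj in E2.
    now rewrite (pullback_ext P E1 E2).
Qed.

Lemma right_adjoint_terminal (t : A) : is_terminal t -> is_terminal (U t).
Proof.
  intros Ht x. destruct (Ht (F x)) as [f _].
  exists (fmap U f \o adj_unit x). split; [exact I|]. intros k _.
  destruct (transpose_ex k) as [k' <-]. now rewrite (terminal_hom_eq f k' Ht).
Qed.

Lemma left_adjoint_coequaliser (r x q : X) (r0 r1 : Hom r x) (e : Hom x q) :
  is_coequaliser r0 r1 e -> is_coequaliser (fmap F r0) (fmap F r1) (fmap F e).
Proof.
  intros Q. apply coequaliser_intro.
  - now rewrite <- !fmap_comp, (proj1 Q).
  - intros y f E.
    destruct (coequaliser_desc Q (f := fmap U f \o adj_unit x)) as [h Eh].
    { now rewrite <- !comp_assoc, <- !unit_nat, !comp_assoc, <- !fmap_comp, E. }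
    destruct (transpose_ex h) as [h' <-]. exists h'. apply transpose_inj.
    now rewrite <- Eh, <- comp_assoc, <- unit_nat, comp_assoc, <- fmap_comp.
  - intros y h k E. apply transpose_inj, (coequaliser_epi Q).
    now rewrite <- !comp_assoc, <- !unit_nat, !comp_assoc, <- !fmap_comp, E.
Qed.

Lemma left_adjoint_regular_epi : preserves_regular_epis F.
Proof.
  intros x y e [r [r0 [r1 Q]]]. exists (F r), (fmap F r0), (fmap F r1).
  now apply left_adjoint_coequaliser.
Qed.

End Adjunctions.

(** * Monadic functors *)

(* With conservativity, the hypothesis of Beck's theorem. *)
Definition split_coequalisers_lift (A X : Category) (U : Functor A X) : Prop :=
  forall (a b : A) (f g : Hom a b) (q : X) (e : Hom (U b) q),
    split_coequaliser (fmap U f) (fmap U g) e ->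
    exists (c : A) (h : Hom b c),
      is_coequaliser f g h /\ is_coequaliser (fmap U f) (fmap U g) (fmap U h).

Section FromComparison.
Variables (X A : Category) (F : Functor X A) (U : Functor A X) (adj : Adjunction F U).
Hypothesis HK : is_equivalence (comparison adj).

Lemma monadic_faithful (a b : A) (f g : Hom a b) : fmap U f = fmap U g -> f = g.
Proof.
  intros E. apply (equivalence_faithful HK). apply alg_hom_ext. exact E.
Qed.

(** The hypothesis says that [h] is a morphism between the algebras that the comparison functor
    assigns to [a] and [b]. *)
Lemma monadic_full (a b : A) (h : Hom (U a) (U b)) :
  h \o fmap U (adj_counit adj a) = fmap U (adj_counit adj b) \o fmap U (fmap F h) ->
  exists f : Hom a b, fmap U f = h.
Proof.
  intros E.
  destruct (equivalence_full HK (a := a) (b := b) (@MkAlgebraHom X (induced_monad adj)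
    (comparison_obj adj a) (comparison_obj adj b) h E)) as [f Hf].
  exists f. exact (f_equal (@alg_hom _ _ _ _) Hf).
Qed.

(** This is essential surjectivity of the comparison functor: the hypotheses are the algebra laws
    for [th], and the last equation makes [i] an algebra morphism. *)
Lemma monadic_algebra (x : X) (th : Hom (U (F x)) x) :
  th \o adj_unit adj x = idm x ->
  th \o fmap U (fmap F th) = th \o fmap U (adj_counit adj (F x)) ->
  exists (a : A) (i : Hom (U a) x), is_iso i /\
    i \o fmap U (adj_counit adj a) = th \o fmap U (fmap F i).
Proof.
  intros E1 E2.
  destruct (equivalence_surj HK (@MkAlgebra X (induced_monad adj) x th E1 E2))
    as [a [i [j [H1 H2]]]].
  exists a, (alg_hom i). split.
  - exists (alg_hom j). split.
    + exact (f_equal (@alg_hom _ _ _ _) H1).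
    + exact (f_equal (@alg_hom _ _ _ _) H2).
  - exact (alg_hom_act i).
Qed.

(** The inverse of an invertible algebra morphism is an algebra morphism, so it lifts to [A]. *)
Lemma monadic_reflects_isos : reflects_isos U.
Proof.
  intros a b f [h [E1 E2]].
  destruct (@monadic_full b a h) as [g Hg].
  - apply (is_iso_cancel_l (m := fmap U f)); [now exists h|].
    rewrite !comp_assoc, E2, comp_idl, <- (fmap_comp U f), <- counit_nat, fmap_comp.
    now rewrite <- comp_assoc, <- !fmap_comp, E2, !fmap_id, comp_idr.
  - exists g. split; apply monadic_faithful; rewrite fmap_comp, fmap_id, Hg; assumption.
Qed.

(** The actions on the objects [U (D j)], composed with the images of the legs under the monad, form
    a cone. The induced map [th] is an algebra structure on the limit in [X], and the object of [A]
    presenting that algebra is the limit. *)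
Lemma monadic_creates_limits (J : Category) (D : Functor J A)
    (L : Cone (functor_comp U D)) :
  is_limit L -> exists L' : Cone D, is_limit L'.
Proof.
  intros HL.
  (* The legs and the universal property are restated over [U (D j)], without the composite
     functor. *)
  pose (l := fun j => leg L j : Hom (apex L) (U (D j))).
  assert (Hl : forall i j (u : Hom i j), fmap U (fmap D u) \o l i = l j)
    by exact (leg_nat L).
  assert (Ext : forall q (h k : Hom q (apex L)), (forall j, l j \o h = l j \o k) -> h = k)
    by exact (limit_ext HL).
  assert (Lift : forall q (f : forall j, Hom q (U (D j))),
    (forall i j (u : Hom i j), fmap U (fmap D u) \o f i = f j) ->
    exists h : Hom q (apex L), forall j, l j \o h = f j) by exact (limit_lift HL).
  clearbody l. set (x := apex L) in *. clearbody x. clear L HL.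
  destruct (Lift _ (fun j => fmap U (adj_counit adj (D j)) \o fmap U (fmap F (l j))))
    as [th Hth].
  { intros i j u.
    rewrite <- (Hl i j u), fmap_comp, fmap_comp, comp_assoc, comp_assoc.
    now rewrite <- !(fmap_comp U), counit_nat. }
  destruct (@monadic_algebra x th) as [a [i [Hi Ei]]].
  - apply Ext. intros j. rewrite comp_assoc, Hth, <- comp_assoc, unit_nat, comp_idr.
    now rewrite comp_assoc, adj_triangle_r, comp_idl.
  - apply Ext. intros j. rewrite !comp_assoc, Hth, <- !comp_assoc, <- !fmap_comp, Hth.
    f_equal.
    now rewrite <- counit_nat, fmap_comp, !comp_assoc, counit_nat.
  - assert (M : forall j, { k : Hom a (D j) | fmap U k = l j \o i }).
    { intros j. apply constructive_indefinite_description, monadic_full.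
      rewrite <- comp_assoc, Ei, comp_assoc, Hth, <- comp_assoc, <- !fmap_comp.
      now rewrite !fmap_comp. }
    assert (HM : forall s t (u : Hom s t),
      fmap D u \o proj1_sig (M s) = proj1_sig (M t)).
    { intros s t u. apply monadic_faithful.
      now rewrite fmap_comp, (proj2_sig (M s)), (proj2_sig (M t)), comp_assoc, Hl. }
    exists (MkCone HM). intros K.
    destruct (Lift _ (fun j => fmap U (leg K j))) as [h Hh].
    { intros s t u. now rewrite <- fmap_comp, leg_nat. }
    destruct Hi as [i' [I1 I2]].
    (* The map [h] ends in the limit object [x]; the inverse of [i] carries it to [U a]. That the
       result is an algebra morphism is checked leg by leg. *)
    destruct (@monadic_full (apex K) a (i' \o h)) as [k Hk].
    { apply (is_iso_cancel_l (m := i)); [now exists i'|].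
      rewrite !comp_assoc, I2, comp_idl, Ei, <- comp_assoc, <- !fmap_comp, comp_assoc.
      rewrite I2, comp_idl. apply Ext. intros j.
      rewrite !comp_assoc, Hh, Hth, <- comp_assoc, <- !fmap_comp, Hh.
      now rewrite counit_nat. }
    exists k. split.
    + intros j. apply monadic_faithful. simpl.
      rewrite fmap_comp, (proj2_sig (M j)).
      etransitivity; [exact (f_equal (comp _) Hk)|].
      now rewrite comp_assoc, (comp_cong_l I2), comp_idr.
    + intros k' Hk'. apply monadic_faithful. etransitivity; [exact Hk|].
      apply (is_iso_cancel_l (m := i)); [now exists i'|].
      rewrite comp_assoc, I2, comp_idl. apply Ext. intros j.
      rewrite Hh, comp_assoc, <- (proj2_sig (M j)), <- fmap_comp. f_equal.
      symmetry. exact (Hk' j).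
Qed.

(** With [T] the monad, the universal property of [T q] descends the action of [b] to a map [th] on
    [x]. The unit law is tested after [q], and associativity, an equation between maps out of
    [T (T x)], after the epimorphism [T (T q)]. *)
Lemma monadic_creates_coequalisers (a b : A) (f g : Hom a b) (x : X) (q : Hom (U b) x) :
  is_coequaliser (fmap U f) (fmap U g) q ->
  is_coequaliser (fmap U (fmap F (fmap U f))) (fmap U (fmap F (fmap U g)))
    (fmap U (fmap F q)) ->
  (forall y (h k : Hom _ y), h \o fmap U (fmap F (fmap U (fmap F q))) =
    k \o fmap U (fmap F (fmap U (fmap F q))) -> h = k) ->
  exists (c : A) (h : Hom b c), is_coequaliser f g h /\
    exists i : Hom (U c) x, is_iso i /\ i \o fmap U h = q.
Proof.
  intros Q TQ TTQ.
  destruct (coequaliser_desc TQ (f := q \o fmap U (adj_counit adj b))) as [th Hth].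
  { rewrite <- !comp_assoc, <- !(fmap_comp U), !counit_nat, !fmap_comp.
    now rewrite !comp_assoc, (proj1 Q). }
  destruct (@monadic_algebra x th) as [c [i [Hi Ei]]].
  - apply (coequaliser_epi Q).
    rewrite <- comp_assoc, <- unit_nat, comp_assoc, Hth, <- comp_assoc, comp_idl.
    now rewrite adj_triangle_r, comp_idr.
  - apply TTQ. rewrite <- !comp_assoc, <- !fmap_comp, Hth.
    rewrite counit_nat, !fmap_comp, !comp_assoc, Hth.
    rewrite <- !comp_assoc. f_equal. now rewrite <- !fmap_comp, counit_nat.
  - pose proof Hi as [i' [I1 I2]].
    destruct (@monadic_full b c (i' \o q)) as [h Hh].
    { apply (is_iso_cancel_l Hi).
      rewrite !comp_assoc, I2, comp_idl, Ei, <- comp_assoc, <- !fmap_comp, comp_assoc.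
      now rewrite I2, comp_idl. }
    assert (Eh : i \o fmap U h = q) by now rewrite Hh, comp_assoc, I2, comp_idl.
    exists c, h. split; [|now exists i]. apply coequaliser_intro.
    + apply monadic_faithful. rewrite !fmap_comp, Hh, <- !comp_assoc. f_equal. apply Q.
    + intros y k Ek.
      destruct (coequaliser_desc Q (f := fmap U k)) as [m Hm].
      { now rewrite <- !fmap_comp, Ek. }
      (* To see that [m \o i] is an algebra morphism, its domain is moved along the isomorphism
         [T i'] and the equation is tested after [T q]. *)
      destruct (@monadic_full c y (m \o i)) as [n Hn].
      { apply (is_iso_cancel_r (e := fmap U (fmap F i'))).
        { do 2 apply is_iso_fmap. now exists i. }
        apply (coequaliser_epi TQ).
        rewrite <- !comp_assoc, <- !fmap_comp, <- !comp_assoc, <- Hh, Eh, Hm.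
        rewrite !counit_nat, !fmap_comp, (comp_assoc i), Eh, comp_assoc, Hm.
        reflexivity. }
      exists n. apply monadic_faithful.
      now rewrite fmap_comp, Hn, <- comp_assoc, Eh.
    + intros y k k' E. apply monadic_faithful, (is_iso_cancel_r (e := i')).
      { now exists i. }
      apply (coequaliser_epi Q). now rewrite <- !comp_assoc, <- Hh, <- !fmap_comp, E.
Qed.

(** A split fork stays split under the monad and its square, which supplies the hypotheses of
    [monadic_creates_coequalisers]. *)
Lemma monadic_split_coequalisers_lift : split_coequalisers_lift U.
Proof.
  intros a b f g q e S.
  pose proof (split_coequaliser_is_coequaliser S) as Q.
  destruct (monadic_creates_coequalisers Q) as [c [h [Hh [i [Hi Ei]]]]].
  - apply split_coequaliser_is_coequaliser, (split_coequaliser_fmap U),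
      (split_coequaliser_fmap F), S.
  - apply coequaliser_epi with (r0 := fmap U (fmap F (fmap U (fmap F (fmap U f)))))
      (r1 := fmap U (fmap F (fmap U (fmap F (fmap U g))))).
    apply split_coequaliser_is_coequaliser. now do 4 apply split_coequaliser_fmap.
  - exists c, h. split; [exact Hh|]. destruct Hi as [j [J1 J2]].
    replace (fmap U h) with (j \o e).
    + apply coequaliser_iso; [exact Q|]. now exists i.
    + now rewrite <- Ei, comp_assoc, J1, comp_idl.
Qed.

End FromComparison.

(** * Beck's monadicity theorem *)

Lemma beck_monadicity (X A : Category) (F : Functor X A) (U : Functor A X)
    (adj : Adjunction F U) :
  reflects_isos U -> split_coequalisers_lift U -> is_equivalence (comparison adj).
Proof.
  intros R B.
  assert (Tri : forall a, fmap U (adj_counit adj a) \o adj_unit adj (U a) = idm (U a))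
    by exact (adj_triangle_r adj).
  (* Every algebra is a split quotient of free ones in [X]; the splittings are the units at [x] and
     at [U (F x)]. *)
  assert (SA : forall (x : X) (th : Hom (U (F x)) x), th \o adj_unit adj x = idm x ->
    th \o fmap U (fmap F th) = th \o fmap U (adj_counit adj (F x)) ->
    split_coequaliser (fmap U (adj_counit adj (F x))) (fmap U (fmap F th)) th).
  { intros x th E1 E2. split; [auto|].
    exists (adj_unit adj x), (adj_unit adj (U (F x))).
    split; [exact E1|split; [apply Tri|apply unit_nat]]. }
  (* Each object of [A] is the coequaliser of its free presentation. The fork under [U] splits, so
     it has a lifted coequaliser [h]; the comparison [k] with the counit is invertible under [U],
     hence invertible. *)
  assert (CE : forall a, is_coequaliser (adj_counit adj (F (U a)))
    (fmap F (fmap U (adj_counit adj a))) (adj_counit adj a)).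
  { intros a.
    assert (S : split_coequaliser (fmap U (adj_counit adj (F (U a))))
      (fmap U (fmap F (fmap U (adj_counit adj a)))) (fmap U (adj_counit adj a))).
    { apply SA; [apply Tri|]. now rewrite <- !fmap_comp, counit_nat. }
    destruct (B _ _ _ _ _ _ S) as [c [h [Q UQ]]].
    destruct (coequaliser_desc Q (f := adj_counit adj a)) as [k Ek].
    { symmetry. apply counit_nat. }
    assert (Ik : is_iso k).
    { apply R, (coequaliser_unique UQ (split_coequaliser_is_coequaliser S)).
      now rewrite <- fmap_comp, Ek. }
    pose proof (coequaliser_iso Q Ik) as W. now rewrite Ek in W. }
  apply is_equivalence_intro.
  - intros a b f g E. apply (coequaliser_epi (CE a)).
    apply (f_equal (@alg_hom _ _ _ _)) in E. simpl in E.
    now rewrite <- !counit_nat, E.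
  - intros a b [h Eh0]. change (Hom (U a) (U b)) in h.
    assert (Eh : h \o fmap U (adj_counit adj a) =
      fmap U (adj_counit adj b) \o fmap U (fmap F h)) by exact Eh0.
    (* Fullness: the transpose of [h] descends along the free presentation of [a] because [h]
       respects the actions. *)
    destruct (coequaliser_desc (CE a) (f := adj_counit adj b \o fmap F h)) as [f Hf].
    { rewrite <- !comp_assoc, <- !fmap_comp, Eh, fmap_comp, <- counit_nat.
      now rewrite !comp_assoc, counit_nat. }
    exists f. apply alg_hom_ext. change (fmap U f = h).
    rewrite <- (comp_idr (fmap U f)), <- (comp_idr h), <- (Tri a), !comp_assoc. f_equal.
    now rewrite <- fmap_comp, Hf, Eh, fmap_comp.
  - intros [x th E1 E2]. simpl in *.
    (* Essential surjectivity: [c] is the coequaliser in [A] of the free presentation of the algebra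
       on [x], and [i] compares [U c] with [x]. *)
    destruct (B _ _ _ _ _ _ (SA _ _ E1 E2)) as [c [h [Q UQ]]].
    pose proof (split_coequaliser_is_coequaliser (SA _ _ E1 E2)) as Q'.
    destruct (coequaliser_desc UQ (proj1 Q')) as [i Ei].
    assert (Hi : is_iso i) by exact (coequaliser_unique UQ Q' Ei).
    destruct Hi as [j [J1 J2]].
    assert (Eh : fmap U h = j \o th) by now rewrite <- Ei, comp_assoc, J1, comp_idl.
    assert (Ea : i \o fmap U (adj_counit adj c) = th \o fmap U (fmap F i)).
    { apply (is_iso_cancel_r (e := fmap U (fmap F j))).
      { do 2 apply is_iso_fmap. now exists i. }
      apply (coequaliser_epi (split_coequaliser_is_coequaliser
        (split_coequaliser_fmap U (split_coequaliser_fmap F (SA _ _ E1 E2))))).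
      rewrite <- !comp_assoc, <- !fmap_comp, <- Eh, Ei, counit_nat, fmap_comp.
      now rewrite comp_assoc, Ei. }
    assert (Eb : j \o th = fmap U (adj_counit adj c) \o fmap U (fmap F j)).
    { apply (is_iso_cancel_l (m := i)); [now exists j|].
      rewrite !comp_assoc, J2, Ea, <- comp_assoc, <- !fmap_comp, J2, !fmap_id.
      now rewrite comp_idl, comp_idr. }
    exists c. unshelve eexists (@MkAlgebraHom X (induced_monad adj) (comparison_obj adj c)
      (@MkAlgebra X (induced_monad adj) x th E1 E2) i Ea).
    exists (@MkAlgebraHom X (induced_monad adj) 
      (@MkAlgebra X (induced_monad adj) x th E1 E2) (comparison_obj adj c) j Eb).
    split; apply alg_hom_ext; assumption.
Qed.

(** * Protomodularity *)

(* Protomodularity without a choice of pullbacks. *)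
Definition reflects_point_isos (C : Category) : Prop :=
  forall (X Y a b pa pb : C) (f : Hom Y X) (al : Hom a X) (sa : Hom X a)
    (be : Hom b X) (sb : Hom X b) (k : Hom a b) (p1 : Hom pa a) (p2 : Hom pa Y)
    (q1 : Hom pb b) (q2 : Hom pb Y) (h : Hom pa pb),
  al \o sa = idm X -> be \o sb = idm X -> be \o k = al -> k \o sa = sb ->
  is_pullback al f p1 p2 -> is_pullback be f q1 q2 ->
  q1 \o h = k \o p1 -> q2 \o h = p2 -> is_iso h -> is_iso k.

Lemma pullback_iso (C : Category) (a b c p q : C) (f : Hom a c) (g : Hom b c)
    (p1 : Hom p a) (p2 : Hom p b) (q1 : Hom q a) (q2 : Hom q b) :
  is_pullback f g p1 p2 -> is_pullback f g q1 q2 ->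
  exists i : Hom p q, is_iso i /\ q1 \o i = p1 /\ q2 \o i = p2.
Proof.
  intros P Q.
  destruct (pullback_lift Q (proj1 P)) as [i [I1 I2]].
  destruct (pullback_lift P (proj1 Q)) as [j [J1 J2]].
  exists i. split; [|auto]. exists j. split.
  - apply (pullback_ext P); rewrite comp_assoc, comp_idr; congruence.
  - apply (pullback_ext Q); rewrite comp_assoc, comp_idr; congruence.
Qed.

Lemma pt_iso (C : Category) (X : C) (P Q : Pt X) (k : Hom P Q) :
  is_iso k <-> is_iso (pt_hom k).
Proof.
  split.
  - intros [l [E1 E2]]. exists (pt_hom l).
    split; [exact (f_equal (@pt_hom _ _ _ _) E1)|exact (f_equal (@pt_hom _ _ _ _) E2)].
  - intros [l [E1 E2]]. unshelve eexists (@MkPtHom C X Q P l _ _).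
    + rewrite <- (pt_hom_map k), <- comp_assoc, E2. apply comp_idr.
    + rewrite <- (pt_hom_sec k), comp_assoc, E1. apply comp_idl.
    + split; apply pt_hom_ext; assumption.
Qed.

(** Any pullback is isomorphic to the chosen one, and under these isomorphisms [h] corresponds to
    the value of the pullback functor at [k]. *)
Lemma reflects_point_isos_iff (C : Category) (H : has_pullbacks C) :
  (forall (Y X : C) (f : Hom Y X), reflects_isos (pt_pullback H f)) <->
  reflects_point_isos C.
Proof.
  split; intros R.
  - intros X Y a b pa pb f al sa be sb k p1 p2 q1 q2 h Ea Eb Ek Es P Q H1 H2 Hh.
    pose (A := @MkPtObj C X a al sa Ea). pose (B := @MkPtObj C X b be sb Eb).
    pose (K := @MkPtHom C X A B k Ek Es : @Hom (Pt X) A B).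
    change (is_iso (pt_hom K)). apply pt_iso, (R Y X f), pt_iso.
    destruct (pullback_iso (pb_spec (Defs.pb H al f)) P) as [i [Hi [I1 I2]]].
    destruct (pullback_iso (pb_spec (Defs.pb H be f)) Q) as [j [Hj [J1 J2]]].
    apply (is_iso_of_comp_l Hj).
    match goal with |- is_iso ?m => replace m with (h \o i) end.
    + now apply is_iso_comp.
    + apply (pullback_ext Q); rewrite !comp_assoc.
      * rewrite H1, J1. simpl. now rewrite pb_lift_fst, <- comp_assoc, I1.
      * rewrite H2, J2. simpl. now rewrite pb_lift_snd.
  - intros Y X f A B K HK. apply pt_iso in HK. apply pt_iso.
    refine (R _ _ _ _ _ _ f (pt_map A) (pt_sec A) (pt_map B) (pt_sec B) (pt_hom K)
      _ _ _ _ _ _ _ _ _ (pb_spec (pb H (pt_map A) f)) (pb_spec (pb H (pt_map B) f))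
      _ _ HK).
    + apply pt_split.
    + apply pt_split.
    + apply pt_hom_map.
    + apply pt_hom_sec.
    + simpl. apply pb_lift_fst.
    + simpl. apply pb_lift_snd.
Qed.

Lemma protomodular_iff (C : Category) :
  protomodular C <-> finitely_complete C /\ reflects_point_isos C.
Proof.
  split.
  - intros [H R]. split; [exact H|]. exact (proj1 (reflects_point_isos_iff _) R).
  - intros [H R]. exists H. now apply reflects_point_isos_iff.
Qed.

Lemma finitely_complete_terminal (C : Category) :
  finitely_complete C -> exists t : C, is_terminal t.
Proof.
  intros H.
  (* A terminal object is a limit of the empty diagram. *)
  pose (J := @MkCategory Empty_set (fun _ _ => unit) (fun _ => tt) (fun _ _ _ _ _ => tt)
    (fun x => match x with end) (fun x => match x with end) (fun x => match x with end)).
  unshelve epose (D := @MkFunctor J C (fun x => match x with end)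
    (fun x => match x with end) _ _); [intros []|intros []|].
  destruct (H J) with (D := D) as [L HL].
  { split; [exists nil; intros []|intros []]. }
  exists (apex L). intros x.
  unshelve edestruct (limit_lift HL (q := x)) as [h _]; [intros []|intros []|].
  exists h. split; [exact I|]. intros k _. apply (limit_ext HL). intros [].
Qed.

(** * Slice categories *)

Section ConeShape.
Variable J : Category.

Definition top_hom (x y : option J) : Type :=
  match y with
  | None => unit
  | Some j => match x with Some i => Hom i j | None => Empty_set end
  end.

(* [J] with a terminal object freely added: a diagram in a slice over [z] is a
   diagram of this shape sending the new object to [z]. *)
Definition with_top : Category.
Proof.
  refine (@MkCategory (option J) top_hom
    (fun x => match x with Some i => idm i | None => tt end)
    (fun x y z => match z return top_hom y z -> top_hom x y -> top_hom x z with
      | None => fun _ _ => tt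
      | Some k => match y return top_hom y (Some k) -> top_hom x y -> top_hom x (Some k) with
        | None => fun v _ => match v with end
        | Some j => match x return top_hom (Some j) (Some k) -> top_hom x (Some j) ->
              top_hom x (Some k) with
          | None => fun _ u => match u with end
          | Some i => fun v u => v \o u
          end
        end
      end) _ _ _).
  - intros [i|] [j|] f; simpl in *; try destruct f; auto using comp_idl.
  - intros [i|] [j|] f; simpl in *; try destruct f; auto using comp_idr.
  - intros [i|] [j|] [k|] [l|] h g f; simpl in *;
      try destruct f; try destruct g; try destruct h; auto using comp_assoc.
Defined.

Lemma finite_with_top : finite_category J -> finite_category with_top.
Proof.
  intros [[l Hl] HH]. split.
  - exists (None :: map Some l). intros [i|]; simpl; [right|now left].
    apply in_map, Hl.
  - intros [i|] [j|]; simpl; [apply HH| | |].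
    + exists (tt :: nil). intros []; simpl; auto.
    + exists nil. intros [].
    + exists (tt :: nil). intros []; simpl; auto.
Qed.

Definition with_top_functor (C : Category) (z : C) (D : Functor J (Slice z)) :
  Functor with_top C.
Proof.
  pose (o := fun x : option J => match x with Some i => sl_obj (D i) | None => z end).
  refine (@MkFunctor with_top C o
    (fun x y => match y return top_hom x y -> Hom (o x) (o y) with
      | None => match x return top_hom x None -> Hom (o x) z with
        | None => fun _ => idm z
        | Some i => fun _ => sl_map (D i)
        end
      | Some j => match x return top_hom x (Some j) -> Hom (o x) (sl_obj (D j)) with
        | None => fun u => match u with end
        | Some i => fun u => sl_hom (fmap D u)
        end
      end) _ _).
  - intros [i|]; simpl; [|reflexivity]. now rewrite fmap_id.
  - intros [i|] [j|] [k|] g f; simpl in *; try destruct f; try destruct g;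
      rewrite ?comp_idl; auto.
    + now rewrite fmap_comp.
    + symmetry. apply sl_hom_map.
Defined.

End ConeShape.

Section Slices.
Variables (C : Category) (z : C).

(** Cones in the slice are cones over the extended diagram in [C]: the leg at the added object is
    the structure map of the vertex. *)
Lemma slice_finitely_complete : finitely_complete C -> finitely_complete (Slice z).
Proof.
  intros H J HJ D.
  destruct (H _ (finite_with_top HJ) (with_top_functor D)) as [L HL].
  pose (A := @MkSliceObj C z (apex L) (leg L None)).
  unshelve epose (l := fun j => @MkSliceHom C z A (D j) (leg L (Some j)) _).
  { exact (@leg_nat _ _ _ L (Some j) None tt). }
  unshelve eexists (@MkCone J (Slice z) D A l _).
  - intros i j u. apply slice_hom_ext. exact (@leg_nat _ _ _ L (Some i) (Some j) u).
  - intros K.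
    unshelve edestruct (limit_lift HL (q := sl_obj (apex K))
      (f := fun x => match x return Hom (sl_obj (apex K)) (with_top_functor D x) with
        | Some j => sl_hom (leg K j) | None => sl_map (apex K) end)) as [h Hh].
    + intros [i|] [j|] u; simpl in *; try destruct u.
      * exact (f_equal (@sl_hom _ _ _ _) (leg_nat K u)).
      * apply sl_hom_map.
      * apply comp_idl.
    + exists (@MkSliceHom C z (apex K) A h (Hh None)). split.
      * intros j. apply slice_hom_ext. exact (Hh (Some j)).
      * intros k Hk. apply slice_hom_ext, (limit_ext HL).
        intros [j|]; (etransitivity; [exact (Hh _)|]).
        -- symmetry. exact (f_equal (@sl_hom _ _ _ _) (Hk j)).
        -- symmetry. exact (sl_hom_map k).
Qed.

Lemma slice_pullback_iff (a b c p : Slice z) (f : Hom a c) (g : Hom b c)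
    (p1 : Hom p a) (p2 : Hom p b) :
  is_pullback f g p1 p2 <->
  is_pullback (sl_hom f) (sl_hom g) (sl_hom p1) (sl_hom p2).
Proof.
  split; intros P.
  - apply pullback_intro.
    + exact (f_equal (@sl_hom _ _ _ _) (proj1 P)).
    + intros q u v E.
      (* A test object of [C] becomes an object over [z] through [u]; commutativity of the square
         puts [v] over [z] as well. *)
      pose (Q := @MkSliceObj C z q (sl_map a \o u)).
      assert (Ev : sl_map b \o v = sl_map Q).
      { simpl. now rewrite <- (sl_hom_map g), <- comp_assoc, <- E, comp_assoc, sl_hom_map. }
      destruct (pullback_lift P (q := Q) (u := @MkSliceHom C z Q a u eq_refl)
        (v := @MkSliceHom C z Q b v Ev)) as [h [H1 H2]].
      * now apply slice_hom_ext.
      * exists (sl_hom h). split.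
        -- exact (f_equal (@sl_hom _ _ _ _) H1).
        -- exact (f_equal (@sl_hom _ _ _ _) H2).
    + intros q h k E1 E2.
      pose (Q := @MkSliceObj C z q (sl_map p \o h)).
      assert (Ek : sl_map p \o k = sl_map Q).
      { simpl. now rewrite <- (sl_hom_map p1), <- !comp_assoc, E1. }
      assert (E : @MkSliceHom C z Q p h eq_refl = @MkSliceHom C z Q p k Ek).
      { apply (pullback_ext P); now apply slice_hom_ext. }
      exact (f_equal (@sl_hom _ _ _ _) E).
  - apply pullback_intro.
    + apply slice_hom_ext, (proj1 P).
    + intros q u v E. apply (f_equal (@sl_hom _ _ _ _)) in E.
      destruct (pullback_lift P E) as [h [H1 H2]].
      unshelve eexists (@MkSliceHom C z q p h _).
      * now rewrite <- (sl_hom_map p1), <- comp_assoc, H1, sl_hom_map.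
      * split; apply slice_hom_ext; assumption.
    + intros q h k E1 E2. apply slice_hom_ext, (pullback_ext P).
      * exact (f_equal (@sl_hom _ _ _ _) E1).
      * exact (f_equal (@sl_hom _ _ _ _) E2).
Qed.

Lemma slice_iso (a b : Slice z) (f : Hom a b) : is_iso f <-> is_iso (sl_hom f).
Proof.
  split.
  - intros [g [E1 E2]]. exists (sl_hom g).
    split; [exact (f_equal (@sl_hom _ _ _ _) E1)|exact (f_equal (@sl_hom _ _ _ _) E2)].
  - intros [g [E1 E2]]. unshelve eexists (@MkSliceHom C z b a g _).
    + rewrite <- (sl_hom_map f), <- comp_assoc, E2. apply comp_idr.
    + split; apply slice_hom_ext; assumption.
Qed.

Lemma slice_coequaliser (r x q : Slice z) (r0 r1 : Hom r x) (e : Hom x q) :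
  is_coequaliser (sl_hom r0) (sl_hom r1) (sl_hom e) -> is_coequaliser r0 r1 e.
Proof.
  intros Q. apply coequaliser_intro.
  - apply slice_hom_ext, Q.
  - intros y f E. apply (f_equal (@sl_hom _ _ _ _)) in E.
    destruct (coequaliser_desc Q E) as [h Hh].
    (* The induced map lies over [z] because this can be tested after the epimorphism [e]. *)
    unshelve eexists (@MkSliceHom C z q y h _).
    + apply (coequaliser_epi Q). now rewrite <- comp_assoc, Hh, !sl_hom_map.
    + now apply slice_hom_ext.
  - intros y h k E. apply slice_hom_ext, (coequaliser_epi Q).
    exact (f_equal (@sl_hom _ _ _ _) E).
Qed.

Lemma slice_regular_epi_intro (H : has_pullbacks C) (x y : Slice z) (e : Hom x y) :
  regular_epi (sl_hom e) -> regular_epi e.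
Proof.
  intros R. pose (P := pb H (sl_hom e) (sl_hom e)).
  pose (r := @MkSliceObj C z (pb_obj P) (sl_map x \o pb_fst P)).
  assert (E : sl_map x \o pb_snd P = sl_map r).
  { simpl. now rewrite <- (sl_hom_map e), <- !comp_assoc, pb_comm. }
  exists r, (@MkSliceHom C z r x (pb_fst P) eq_refl), (@MkSliceHom C z r x (pb_snd P) E).
  apply slice_coequaliser, (regular_epi_coequaliser_of_kernel_pair R), (pb_spec P).
Qed.

Definition slice_forget : Functor (Slice z) C.
Proof.
  refine (@MkFunctor (Slice z) C (fun a => sl_obj a) (fun a b f => sl_hom f) _ _);
    reflexivity.
Defined.

(** The forgetful functor preserves pullbacks and reflects isomorphisms, so the whole configuration
    can be moved to [C]. *)
Lemma slice_reflects_point_isos : reflects_point_isos C -> reflects_point_isos (Slice z).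
Proof.
  intros R X Y a b pa pb f al sa be sb k p1 p2 q1 q2 h E1 E2 E3 E4 P Q E5 E6 Hh.
  apply slice_iso. apply slice_iso in Hh.
  apply slice_pullback_iff in P. apply slice_pullback_iff in Q.
  refine (R _ _ _ _ _ _ (sl_hom f) _ (sl_hom sa) _ (sl_hom sb) (sl_hom k) _ _ _ _
    (sl_hom h) _ _ _ _ P Q _ _ Hh).
  - exact (f_equal (@sl_hom _ _ _ _) E1).
  - exact (f_equal (@sl_hom _ _ _ _) E2).
  - exact (f_equal (@sl_hom _ _ _ _) E3).
  - exact (f_equal (@sl_hom _ _ _ _) E4).
  - exact (f_equal (@sl_hom _ _ _ _) E5).
  - exact (f_equal (@sl_hom _ _ _ _) E6).
Qed.

Lemma slice_finite_coproducts : has_finite_coproducts C -> has_finite_coproducts (Slice z).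
Proof.
  intros H I HI X.
  destruct (H I HI (fun i => sl_obj (X i))) as [s [inj Hs]].
  destruct (Hs z (fun i => sl_map (X i))) as [m [Hm _]].
  pose (S := @MkSliceObj C z s m).
  exists S, (fun i => @MkSliceHom C z (X i) S (inj i) (Hm i)).
  intros y f. destruct (Hs (sl_obj y) (fun i => sl_hom (f i))) as [h [Hh U]].
  unshelve eexists (@MkSliceHom C z S y h _).
  - simpl. destruct (Hs z (fun i => sl_map (X i))) as [m' [_ U']].
    transitivity m'; [symmetry|]; apply U'; [|exact Hm]. intros i.
    now rewrite <- comp_assoc, Hh, sl_hom_map.
  - split.
    + intros i. apply slice_hom_ext, Hh.
    + intros k Hk. apply slice_hom_ext, U. intros i.
      exact (f_equal (@sl_hom _ _ _ _) (Hk i)).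
Qed.

(** The identity of [z] is terminal in the slice over [z], and initiality of [z] makes it initial
    too. *)
Lemma slice_initial_pointed : is_initial z -> pointed (Slice z).
Proof.
  intros Hz. exists (@MkSliceObj C z z (idm z)). split; intros x.
  - destruct (Hz (sl_obj x)) as [h _].
    unshelve eexists (@MkSliceHom C z (@MkSliceObj C z z (idm z)) x h _).
    + apply (initial_hom_eq _ _ Hz).
    + split; [exact I|]. intros k _. apply slice_hom_ext, (initial_hom_eq _ _ Hz).
  - exists (@MkSliceHom C z x (@MkSliceObj C z z (idm z)) (sl_map x) (comp_idl _)).
    split; [exact I|]. intros k _. apply slice_hom_ext. simpl.
    rewrite <- (sl_hom_map k). apply comp_idl.
Qed.

End Slices.

(** * Base change adjunctions and products with a fixed object *)

Definition terminal_slice_obj (C : Category) (t : C) (Ht : is_terminal t) (a : C) :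
  Slice t :=
  @MkSliceObj C t a (proj1_sig (constructive_indefinite_description _ (Ht a))).

(** This identifies [C] with its slice over a terminal object, so that base change along a map into
    [t] can be applied to objects of [C]. *)
Definition terminal_slice (C : Category) (t : C) (Ht : is_terminal t) : Functor C (Slice t).
Proof.
  unshelve refine (@MkFunctor C (Slice t) (terminal_slice_obj Ht)
    (fun a b f => @MkSliceHom C t (terminal_slice_obj Ht a) (terminal_slice_obj Ht b) f _)
    _ _).
  - abstract (apply (terminal_hom_eq _ _ Ht)).
  - intros; now apply slice_hom_ext.
  - intros; now apply slice_hom_ext.
Defined.

Section BaseChange.
Variables (C : Category) (H : has_pullbacks C).

Definition slice_sum (Y X : C) (f : Hom Y X) : Functor (Slice Y) (Slice X).
Proof.
  pose (o := fun a : Slice Y => @MkSliceObj C X (sl_obj a) (f \o sl_map a)).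
  unshelve refine (@MkFunctor (Slice Y) (Slice X) o
    (fun a b h => @MkSliceHom C X (o a) (o b) (sl_hom h) _) _ _).
  - abstract (simpl; now rewrite <- comp_assoc, sl_hom_map).
  - intros; now apply slice_hom_ext.
  - intros; now apply slice_hom_ext.
Defined.

(** The unit pairs the identity with the structure map, and the counit is the first projection. *)
Definition slice_sum_adjunction (Y X : C) (f : Hom Y X) :
  Adjunction (slice_sum f) (slice_pullback H f).
Proof.
  unshelve epose (et := @MkNatTrans _ _ (functor_id (Slice Y))
    (functor_comp (slice_pullback H f) (slice_sum f))
    (fun a => @MkSliceHom C Y a (slice_pb_obj H f (slice_sum f a))
      (pb_lift (pb H (sl_map (slice_sum f a)) f) (u := idm _) (v := sl_map a) _) _) _).
  - apply comp_idr.
  - apply pb_lift_snd.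
  - intros a b h. apply slice_hom_ext, pb_hom_ext; simpl.
    + rewrite !comp_assoc, !pb_lift_fst, <- comp_assoc, pb_lift_fst.
      now rewrite comp_idl, comp_idr.
    + now rewrite !comp_assoc, !pb_lift_snd, sl_hom_map.
  - unshelve epose (ep := @MkNatTrans _ _ (functor_comp (slice_sum f) (slice_pullback H f))
      (functor_id (Slice X))
      (fun a => @MkSliceHom C X (slice_sum f (slice_pb_obj H f a)) a
        (pb_fst (pb H (sl_map a) f)) _) _).
    + apply pb_comm.
    + intros a b h. apply slice_hom_ext. apply pb_lift_fst.
    + apply (@MkAdjunction _ _ _ _ et ep).
      * intros a. apply slice_hom_ext. apply pb_lift_fst.
      * intros a. apply slice_hom_ext, pb_hom_ext; simpl.
        -- now rewrite !comp_assoc, !pb_lift_fst, <- comp_assoc, pb_lift_fst, comp_idr.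
        -- now rewrite !comp_assoc, !pb_lift_snd, comp_idr.
Defined.

Variables (t : C) (Ht : is_terminal t) (z : C) (m : Hom z t).

(** It sends [a] to the projection from the product of [a] and [z] to [z], the product being a
    pullback over the terminal object. *)
Definition product_functor : Functor C (Slice z) :=
  functor_comp (slice_pullback H m) (terminal_slice Ht).

Definition product_adjunction : Adjunction (slice_forget z) product_functor.
Proof.
  unshelve epose (et := @MkNatTrans _ _ (functor_id (Slice z))
    (functor_comp product_functor (slice_forget z))
    (fun a => @MkSliceHom C z a (product_functor (sl_obj a))
      (pb_lift (pb H (sl_map (terminal_slice Ht (sl_obj a))) m)
        (u := idm _) (v := sl_map a) _) _) _).
  - apply (terminal_hom_eq _ _ Ht).
  - apply pb_lift_snd.
  - intros a b h. apply slice_hom_ext, pb_hom_ext; simpl.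
    + rewrite !comp_assoc, !pb_lift_fst, <- comp_assoc, pb_lift_fst.
      now rewrite comp_idl, comp_idr.
    + now rewrite !comp_assoc, !pb_lift_snd, sl_hom_map.
  - unshelve epose (ep := @MkNatTrans _ _ (functor_comp (slice_forget z) product_functor)
      (functor_id C) (fun a => pb_fst (pb H (sl_map (terminal_slice Ht a)) m)) _).
    + intros a b h. apply pb_lift_fst.
    + apply (@MkAdjunction _ _ _ _ et ep).
      * intros a. apply pb_lift_fst.
      * intros a. apply slice_hom_ext, pb_hom_ext; simpl.
        -- now rewrite !comp_assoc, !pb_lift_fst, <- comp_assoc, pb_lift_fst, comp_idr.
        -- now rewrite !comp_assoc, !pb_lift_snd, comp_idr.
Defined.

End BaseChange.

(** * Regularity of slices and of categories of algebras *)

(** Kernel pairs and their coequalisers are computed in [C]. Regular epimorphisms of the slice are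
    regular in [C] because the forgetful functor is left adjoint to taking products with [z], so
    stability in [C] applies. *)
Lemma slice_regular (C : Category) (z : C) : regular C -> regular (Slice z).
Proof.
  intros [FC [Coeq Stab]].
  pose proof (finitely_complete_has_pullbacks FC) as H.
  destruct (finitely_complete_terminal FC) as [t Ht].
  destruct (Ht z) as [m _].
  split; [now apply slice_finitely_complete|split].
  - intros x y r f r0 r1 P. apply slice_pullback_iff in P.
    destruct (Coeq _ _ _ _ _ _ P) as [q [e Q]].
    destruct (coequaliser_desc Q (f := sl_map x)) as [n Hn].
    { now rewrite !sl_hom_map. }
    exists (@MkSliceObj C z q n), (@MkSliceHom C z x (@MkSliceObj C z q n) e Hn).
    now apply slice_coequaliser.
  - intros a b c p f g p1 p2 P Hf. apply slice_pullback_iff in P.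
    apply (slice_regular_epi_intro H), (Stab _ _ _ _ _ _ _ _ P).
    exact (left_adjoint_regular_epi (product_adjunction H Ht m) Hf).
Qed.

Section MonadicRegular.
Variables (X A : Category) (F : Functor X A) (U : Functor A X) (adj : Adjunction F U).
Hypothesis HK : is_equivalence (comparison adj).

Lemma monadic_finitely_complete : finitely_complete X -> finitely_complete A.
Proof.
  intros H J HJ D. destruct (H J HJ (functor_comp U D)) as [L HL].
  exact (monadic_creates_limits HK HL).
Qed.

Lemma monadic_reflects_point_isos : reflects_point_isos X -> reflects_point_isos A.
Proof.
  intros R Y Z a b pa pb f al sa be sb k p1 p2 q1 q2 h E1 E2 E3 E4 P Q E5 E6 Hh.
  apply (monadic_reflects_isos HK).
  refine (R _ _ _ _ _ _ _ _ (fmap U sa) _ (fmap U sb) (fmap U k) _ _ _ _ (fmap U h)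
    _ _ _ _ (right_adjoint_pullback adj P) (right_adjoint_pullback adj Q) _ _
    (is_iso_fmap U Hh)); rewrite <- !fmap_comp, <- ?fmap_id; f_equal; assumption.
Qed.

Hypothesis RX : regular X.
Hypothesis TR : preserves_regular_epis (monad_functor (induced_monad adj)).
Hypothesis TK : preserves_kernel_pairs (monad_functor (induced_monad adj)).

(** Let [e] be the coequaliser in [X] of the image under [U] of the pair, and [T] the monad. Then
    [T e] is a regular epimorphism whose kernel pair is the image of that of [e], hence the
    coequaliser of that image, and [T (T e)] is epi. *)
Lemma monadic_kernel_pair_coequaliser (x y r : A) (f : Hom x y) (r0 r1 : Hom r x) :
  is_kernel_pair f r0 r1 -> exists (c : A) (h : Hom x c),
    is_coequaliser r0 r1 h /\ is_coequaliser (fmap U r0) (fmap U r1) (fmap U h).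
Proof.
  intros P. pose proof (right_adjoint_pullback adj P) as UP.
  destruct RX as [_ [Coeq _]].
  destruct (Coeq _ _ _ _ _ _ UP) as [q [e Q]].
  assert (Re : regular_epi e) by (do 3 eexists; exact Q).
  pose proof (TK (kernel_pair_of_coequaliser UP Q)) as TP.
  pose proof (TR Re) as TRe. pose proof (TR TRe) as [s [s0 [s1 TTQ]]].
  destruct (monadic_creates_coequalisers HK Q
    (regular_epi_coequaliser_of_kernel_pair TRe TP) (coequaliser_epi TTQ))
    as [c [h [Hh [i [[j [J1 J2]] Ei]]]]].
  exists c, h. split; [exact Hh|].
  replace (fmap U h) with (j \o e).
  - apply coequaliser_iso; [exact Q|]. now exists i.
  - now rewrite <- Ei, comp_assoc, J1, comp_idl.
Qed.

(** Both sides say that [e] agrees up to isomorphism with the coequaliser [h] of its kernel pair: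
    [U] preserves this coequaliser and reflects invertibility of the comparison [k]. *)
Lemma monadic_regular_epi_iff (x y : A) (e : Hom x y) :
  regular_epi e <-> regular_epi (fmap U e).
Proof.
  destruct (finitely_complete_has_pullbacks (monadic_finitely_complete (proj1 RX)) e e)
    as [[r r0 r1 P]].
  destruct (monadic_kernel_pair_coequaliser P) as [c [h [Q UQ]]].
  destruct (coequaliser_desc Q (proj1 P)) as [k Ek].
  split; intros Re.
  - pose proof (regular_epi_coequaliser_of_kernel_pair Re P) as Qe.
    pose proof (coequaliser_unique Q Qe Ek) as Hk.
    exists (U r), (fmap U r0), (fmap U r1). rewrite <- Ek, fmap_comp.
    apply coequaliser_iso; [exact UQ|]. now apply is_iso_fmap.
  - exists r, r0, r1. rewrite <- Ek. apply coequaliser_iso; [exact Q|].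
    apply (monadic_reflects_isos HK).
    apply (coequaliser_unique UQ (regular_epi_coequaliser_of_kernel_pair Re
      (right_adjoint_pullback adj P))).
    now rewrite <- fmap_comp, Ek.
Qed.

Lemma monadic_regular : regular A.
Proof.
  split; [exact (monadic_finitely_complete (proj1 RX))|split].
  - intros x y r f r0 r1 P.
    destruct (monadic_kernel_pair_coequaliser P) as [c [h [Q _]]]. now exists c, h.
  - intros a b c p f g p1 p2 P Hf. apply monadic_regular_epi_iff.
    apply (proj2 (proj2 RX) _ _ _ _ _ _ _ _ (right_adjoint_pullback adj P)).
    now apply monadic_regular_epi_iff.
Qed.

End MonadicRegular.

(** * Descent along the map from the initial to the terminal object *)

(** A fork that splits under [M] splits under [V M], hence under [W], and lifts. The comparison [k]
    from the split quotient to the image of the lift is invertible under [V], where both are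
    coequalisers of isomorphic pairs. *)
Lemma split_coequalisers_lift_cancel (C D X : Category) (M : Functor C D)
    (V : Functor D X) (W : Functor C X) (t : NatTrans (functor_comp V M) W) :
  (forall c, is_iso (t c)) -> reflects_isos V -> split_coequalisers_lift W ->
  split_coequalisers_lift M.
Proof.
  intros It RV BW a b f g q e S.
  destruct (split_coequaliser_transport It (split_coequaliser_fmap V S))
    as [e' [S' Ee']].
  destruct (BW _ _ _ _ _ _ S') as [c [h [Q WQ]]].
  exists c, h. split; [exact Q|].
  pose proof (split_coequaliser_is_coequaliser S) as Qe.
  destruct (coequaliser_desc Qe (f := fmap M h)) as [k Ek].
  { now rewrite <- !fmap_comp, (proj1 Q). }
  rewrite <- Ek. apply coequaliser_iso; [exact Qe|].
  apply RV, (is_iso_of_comp_l (It c)).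
  apply (coequaliser_unique (split_coequaliser_is_coequaliser S') WQ).
  apply (is_iso_cancel_r (It b)).
  rewrite <- comp_assoc, Ee'. etransitivity; [|exact (naturality t h)].
  simpl. now rewrite <- Ek, fmap_comp, comp_assoc.
Qed.

Lemma reflects_isos_cancel (C D X : Category) (M : Functor C D)
    (V : Functor D X) (W : Functor C X) (t : NatTrans (functor_comp V M) W) :
  (forall c, is_iso (t c)) -> reflects_isos W -> reflects_isos M.
Proof.
  intros It RW a b f Hf. apply RW, (is_iso_of_comp_r (It a)).
  rewrite <- naturality. apply is_iso_comp; [|apply It]. now apply (is_iso_fmap V).
Qed.

(** A coequaliser lifted to [A] has its unique map to [t] as structure map. *)
Lemma terminal_slice_split_coequalisers_lift (A X : Category) (U : Functor A X) (t : A) :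
  is_terminal t -> split_coequalisers_lift U ->
  split_coequalisers_lift (functor_comp U (slice_forget t)).
Proof.
  intros Ht B a b f g q e S.
  destruct (B _ _ (sl_hom f) (sl_hom g) q e S) as [c [h [Q UQ]]].
  destruct (Ht c) as [n _].
  exists (@MkSliceObj A t c n),
    (@MkSliceHom A t b (@MkSliceObj A t c n) h (terminal_hom_eq _ _ Ht)).
  split; [now apply slice_coequaliser|exact UQ].
Qed.

Definition slice_functor (A X : Category) (U : Functor A X) (z : A) :
  Functor (Slice z) (Slice (U z)).
Proof.
  pose (o := fun a : Slice z => @MkSliceObj X (U z) (U (sl_obj a)) (fmap U (sl_map a))).
  unshelve refine (@MkFunctor (Slice z) (Slice (U z)) o
    (fun a b f => @MkSliceHom X (U z) (o a) (o b) (fmap U (sl_hom f)) _) _ _).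
  - abstract (simpl; now rewrite <- fmap_comp, sl_hom_map).
  - intros; apply slice_hom_ext, fmap_id.
  - intros; apply slice_hom_ext, fmap_comp.
Defined.

Section Descent.
Variables (X A : Category) (F : Functor X A) (U : Functor A X) (adj : Adjunction F U).
Hypothesis HK : is_equivalence (comparison adj).
Variables (HX : has_pullbacks X) (HA : has_pullbacks A).
Hypothesis RX : reflects_point_isos X.
Variables (z t : A) (m : Hom z t) (Hz : is_initial z) (Ht : is_terminal t).
Variables (x0 : X) (H0 : is_terminal x0) (o : Hom x0 (U z)).

(* The kernel of [U a -> U z]; together with base change along [z -> t] it recovers
   [U], since [U z -> U t] is split by the zero map. *)
Let kernel_functor : Functor (Slice z) X :=
  functor_comp (slice_forget x0)
    (functor_comp (slice_pullback HX o) (slice_functor U z)).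

Lemma kernel_functor_reflects_isos : reflects_isos kernel_functor.
Proof.
  intros a b k Hk. apply slice_iso, (monadic_reflects_isos HK).
  (* Initiality of [z] makes these maps sections of the structure maps and makes [k] commute with
     them, so [U] yields a morphism of points over [U z]. *)
  destruct (Hz (sl_obj a)) as [sa _], (Hz (sl_obj b)) as [sb _].
  refine (RX _ _ _ _ (pb_spec (pb HX (fmap U (sl_map a)) o))
    (pb_spec (pb HX (fmap U (sl_map b)) o)) _ _ Hk (sa := fmap U sa) (sb := fmap U sb)).
  - rewrite <- fmap_comp, <- fmap_id. f_equal. apply (initial_hom_eq _ _ Hz).
  - rewrite <- fmap_comp, <- fmap_id. f_equal. apply (initial_hom_eq _ _ Hz).
  - now rewrite <- fmap_comp, sl_hom_map.
  - rewrite <- fmap_comp. f_equal. apply (initial_hom_eq _ _ Hz).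
  - apply pb_lift_fst.
  - apply pb_lift_snd.
Qed.

(** Pasting the kernel square onto the image of the base change square gives a pullback along the
    composite from [x0] to [U t]. Both ends are terminal, so the composite is invertible, and so is
    the opposite projection. *)
Lemma kernel_functor_base_change :
  naturally_isomorphic (functor_comp kernel_functor (slice_pullback HA m))
    (functor_comp U (slice_forget t)).
Proof.
  unshelve eexists (@MkNatTrans _ _ (functor_comp kernel_functor (slice_pullback HA m))
    (functor_comp U (slice_forget t))
    (fun a => fmap U (pb_fst (pb HA (sl_map a) m)) \o
      pb_fst (pb HX (fmap U (pb_snd (pb HA (sl_map a) m))) o)) _).
  - intros a b f. simpl.
    rewrite <- comp_assoc, pb_lift_fst, comp_assoc, <- fmap_comp, pb_lift_fst.
    now rewrite fmap_comp, comp_assoc.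
  - intros a.
    pose proof (right_adjoint_pullback adj (pb_spec (pb HA (sl_map a) m))) as P.
    pose proof (pb_spec (pb HX (fmap U (pb_snd (pb HA (sl_map a) m))) o)) as Q.
    apply (pullback_along_iso (pullback_paste P Q)).
    pose proof (right_adjoint_terminal adj Ht) as H1.
    destruct (H0 (U t)) as [n _]. exists n.
    split; [apply (terminal_hom_eq _ _ H0)|apply (terminal_hom_eq _ _ H1)].
Qed.

Lemma initial_terminal_effective_descent : effective_descent HA m.
Proof.
  destruct kernel_functor_base_change as [tau Htau].
  exists (slice_sum m), (slice_sum_adjunction HA m). apply beck_monadicity.
  - apply (reflects_isos_cancel Htau). intros a b f Hf.
    apply slice_iso, (monadic_reflects_isos HK), Hf.
  - apply (split_coequalisers_lift_cancel Htau kernel_functor_reflects_isos).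
    apply (terminal_slice_split_coequalisers_lift Ht).
    exact (monadic_split_coequalisers_lift HK).
Qed.

End Descent.

(** Beck's condition is transported from base change along [m] through the identification of [C]
    with its slice over [t]. This gives monadicity with [slice_forget z] as left adjoint, which
    makes the monad explicit. *)
Lemma product_functor_monadic (C : Category) (H : has_pullbacks C) (z t : C)
    (Ht : is_terminal t) (m : Hom z t) :
  effective_descent H m -> is_equivalence (comparison (product_adjunction H Ht m)).
Proof.
  intros [F [adj HK]]. apply beck_monadicity.
  - intros a b f Hf.
    apply (monadic_reflects_isos HK (f := fmap (terminal_slice Ht) f)) in Hf.
    now apply slice_iso in Hf.
  - intros a b f g q e S.
    destruct (monadic_split_coequalisers_lift HK (f := fmap (terminal_slice Ht) f)
      (g := fmap (terminal_slice Ht) g) S) as [[c n] [h [Q UQ]]].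
    (* Maps to [t] are unique, so the lifted object is in the image of [terminal_slice]. *)
    assert (E : n = sl_map (terminal_slice_obj Ht c)) by apply (terminal_hom_eq _ _ Ht).
    subst n. exists c, (sl_hom h). split.
    + apply coequaliser_intro.
      * exact (f_equal (@sl_hom _ _ _ _) (proj1 Q)).
      * intros y k Ek.
        destruct (coequaliser_desc Q (f := fmap (terminal_slice Ht) k)) as [l Hl].
        { now apply slice_hom_ext. }
        exists (sl_hom l). exact (f_equal (@sl_hom _ _ _ _) Hl).
      * intros y k l E.
        assert (E' : fmap (terminal_slice Ht) k = fmap (terminal_slice Ht) l).
        { apply (coequaliser_epi Q). now apply slice_hom_ext. }
        exact (f_equal (@sl_hom _ _ _ _) E').
    + assert (Eh : h = fmap (terminal_slice Ht) (sl_hom h)) by now apply slice_hom_ext.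
      rewrite Eh in UQ. exact UQ.
Qed.

(** * Passing between the three conditions *)

Lemma finite_coproducts_initial (C : Category) :
  has_finite_coproducts C -> exists z : C, is_initial z.
Proof.
  intros H.
  destruct (H Empty_set) with (X := fun x : Empty_set => match x return C with end)
    as [z [inj Hz]].
  { exists nil. intros []. }
  exists z. intros y. destruct (Hz y (fun x => match x with end)) as [h [_ U]].
  exists h. split; [exact I|]. intros k _. apply U. intros [].
Qed.

(** The product of [e] with [z] is the pullback of [e] along the projection from the product of [y]
    and [z] to [y]. *)
Lemma product_functor_preserves_regular_epis (C : Category) (H : has_pullbacks C) (z t : C)
    (Ht : is_terminal t) (m : Hom z t) :
  regular C -> preserves_regular_epis (product_functor H Ht m).
Proof.
  intros [_ [_ Stab]] x y e He. apply (slice_regular_epi_intro H).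
  set (Px := pb H (sl_map (terminal_slice Ht x)) m).
  set (Py := pb H (sl_map (terminal_slice Ht y)) m).
  pose (k := sl_hom (fmap (product_functor H Ht m) e) : Hom (pb_obj Px) (pb_obj Py)).
  change (regular_epi k).
  assert (E1 : pb_fst Py \o k = e \o pb_fst Px) by apply pb_lift_fst.
  assert (E2 : pb_snd Py \o k = pb_snd Px) by apply pb_lift_snd.
  clearbody k. refine (Stab _ _ _ _ e (pb_fst Py) (pb_fst Px) _ _ He).
  apply pullback_intro; [now symmetry| |].
  - intros q u v E.
    destruct (pullback_lift (pb_spec Px) (u := u) (v := pb_snd Py \o v)) as [h [H1 H2]].
    { apply (terminal_hom_eq _ _ Ht). }
    exists h. split; [exact H1|]. apply pb_hom_ext; rewrite comp_assoc.
    + rewrite E1, <- comp_assoc. exact (eq_trans (f_equal (comp e) H1) E).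
    + now rewrite E2.
  - intros q h h' H1 H2. apply (pullback_ext (pb_spec Px)); [exact H1|].
    now rewrite <- E2, <- !comp_assoc, H2.
Qed.

Lemma ideally_regular_monad (A : Category) : ideally_regular A ->
  exists (X : Category) (U : Functor A X) (F : Functor X A) (adj : Adjunction F U),
    is_equivalence (comparison adj) /\ has_finite_coproducts X /\ homological X /\
    preserves_regular_epis (monad_functor (induced_monad adj)) /\
    preserves_kernel_pairs (monad_functor (induced_monad adj)).
Proof.
  intros [Reg [Pro [Cop [H Desc]]]].
  destruct (finitely_complete_terminal (proj1 Reg)) as [t Ht].
  destruct (finite_coproducts_initial Cop) as [z Hz].
  destruct (Ht z) as [m _].
  exists (Slice z), (product_functor H Ht m), (slice_forget z),
    (product_adjunction H Ht m).
  split; [now apply product_functor_monadic, Desc|].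
  split; [now apply slice_finite_coproducts|].
  split.
  { split; [now apply slice_initial_pointed|]. split; [now apply slice_regular|].
    apply protomodular_iff in Pro. apply protomodular_iff. split.
    - now apply slice_finitely_complete.
    - now apply slice_reflects_point_isos. }
  split.
  (* The monad is the forgetful functor followed by the product functor. The former preserves
     regular epimorphisms as a left adjoint, and kernel pairs because pullbacks in a slice are
     computed in [A]. *)
  - intros x y e He. apply (product_functor_preserves_regular_epis H Ht m Reg).
    exact (left_adjoint_regular_epi (product_adjunction H Ht m) He).
  - intros x y r f r0 r1 P. apply slice_pullback_iff in P.
    exact (right_adjoint_pullback (product_adjunction H Ht m) P).
Qed.

Lemma ideally_regular_of_monadic (A X : Category) (U : Functor A X) :
  regular A -> has_finite_coproducts A -> monadic U -> homological X -> ideally_regular A.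
Proof.
  intros Reg Cop [F [adj HK]] [[x0 [I0 T0]] [_ ProX]].
  apply protomodular_iff in ProX as [FX RX].
  split; [exact Reg|]. split.
  { apply protomodular_iff. split; [apply Reg|].
    exact (monadic_reflects_point_isos HK RX). }
  split; [exact Cop|].
  exists (finitely_complete_has_pullbacks (proj1 Reg)). intros z t m Hz Ht.
  (* The zero object [x0] is used as initial here, to map to [U z], and as terminal in the descent
     argument. *)
  destruct (I0 (U z)) as [o _].
  exact (initial_terminal_effective_descent HK (finitely_complete_has_pullbacks FX)
    (finitely_complete_has_pullbacks (proj1 Reg)) RX m Hz Ht T0 o).
Qed.

Theorem theorem2p2 (A : Category) :
  (ideally_regular A <->
   regular A /\ has_finite_coproducts A /\
   exists (X : Category) (U : Functor A X),
     monadic U /\ homological X /\ has_finite_coproducts X)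
  /\
  (ideally_regular A <->
   exists (X : Category) (U : Functor A X) (F : Functor X A) (adj : Adjunction F U),
     is_equivalence (comparison adj) /\
     has_finite_coproducts A /\ has_finite_coproducts X /\
     homological X /\
     preserves_regular_epis (monad_functor (induced_monad adj)) /\
     preserves_kernel_pairs (monad_functor (induced_monad adj))).
Proof.
  split; split.
  - intros HA.
    destruct (ideally_regular_monad HA) as [X [U [F [adj [HK [Cop [Hom [_ _]]]]]]]].
    destruct HA as [Reg [_ [CopA _]]]. split; [exact Reg|]. split; [exact CopA|].
    exists X, U. split; [|now split]. now exists F, adj.
  - intros [Reg [Cop [X [U [M [Hom _]]]]]]. exact (ideally_regular_of_monadic Reg Cop M Hom).
  - intros HA.
    destruct (ideally_regular_monad HA) as [X [U [F [adj [HK [Cop [Hom [TR TK]]]]]]]].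
    exists X, U, F, adj. split; [exact HK|]. split; [apply HA|auto].
  - intros [X [U [F [adj [HK [CopA [_ [Hom [TR TK]]]]]]]]].
    (* Condition (c) is reduced to (b): the hypotheses on the monad serve to make [A] regular. *)
    apply (ideally_regular_of_monadic (U := U)); auto.
    + apply (monadic_regular HK); [apply Hom|exact TR|exact TK].
    + now exists F, adj.
Qed.
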